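(* Let $D\subsetneq\mathbb{R}^2$ be a nonempty connected open set, and let $S\subset\mathbb{R}^3$ be an open Riemann surface (a smooth surface embedded in $\mathbb{R}^3$, with the induced metric and conformal structure) with smooth conformal parameterization $\phi:D\to S\subset\mathbb{R}^3$, conformal factor $\lambda:D\to(0,\infty)$ and mean curvature $H:D\to\mathbb{R}$. Let $U\subset D$ be a boundary neighborhood, i.e. $U=D\cap V$ for some open set $V\subset\mathbb{R}^2$ containing $\partial D$. Then, given the boundary value $\phi|_U$, the surface $S$ is uniquely determined by $\lambda$ and $H$. That is: if $\tilde S\subset\mathbb{R}^3$ is another such surface with smooth conformal parameterization $\tilde\phi:D\to\tilde S\subset\mathbb{R}^3$ having the same conformal factor $\lambda$ and the same mean curvature $H$ on $D$, and if $\tilde\phi|_U=\phi|_U$, then $\tilde\phi=\phi$ on $D$, and so $\tilde S=S$.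
   Context: Let $(u,v)$ be the coordinates on $D\subset\mathbb{R}^2$. A conformal parameterization of a surface $S\subset\mathbb{R}^3$ is a smooth parameterization $\phi:D\to S$ (a bijective immersion onto $S$, viewed as an $\mathbb{R}^3$-valued position vector $\phi=(X,Y,Z)$) such that $\langle\phi_u,\phi_v\rangle=0$ and $\langle\phi_u,\phi_u\rangle=\langle\phi_v,\phi_v\rangle=\lambda^2$ for a positive smooth function $\lambda$ on $D$. The function $\lambda$ is called the conformal factor; thus the first fundamental form is $ds^2=\lambda(u,v)^2(du^2+dv^2)$. The unit normal is $\vec n=(\phi_u\times\phi_v)/|\phi_u\times\phi_v|$. The mean curvature $H$ is the average of the two principal curvatures with respect to $\vec n$, regarded as a function on $D$ through $\phi$; equivalently $H=\frac{1}{2\lambda^2}\langle\Delta\phi,\vec n\rangle$ with $\Delta=\partial_u^2+\partial_v^2$ applied componentwise. *)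

(* Defs.v *)
From mathcomp Require Import all_boot all_order all_algebra.
From mathcomp Require Import all_classical all_reals all_analysis.

Set Implicit Arguments.
Unset Strict Implicit.
Unset Printing Implicit Defensive.

Import Order.TTheory GRing.Theory Num.Theory.
Import numFieldNormedType.Exports.

Local Open Scope classical_set_scope.
Local Open Scope ring_scope.

Definition boundary (T : topologicalType) (A : set T) : set T :=
  closure A `\` interior A.

Section Smoothness.
Variables (R : realType) (n : nat) (V : normedModType R).
Implicit Types (f : 'rV[R]_n.+1 -> V) (D : set 'rV[R]_n.+1).

Definition partial (i : 'I_n.+1) f : 'rV[R]_n.+1 -> V :=
  fun p => 'D_(delta_mx 0 i) f p.

Definition iter_partial (s : seq 'I_n.+1) f : 'rV[R]_n.+1 -> V :=
  foldr partial f s.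

(* Used for open D only: partial derivatives are taken in the ambient space,
   so at a point of an open D they depend only on the restriction of f to D. *)
Definition smooth_on D f : Prop :=
  forall (s : seq 'I_n.+1) (p : 'rV[R]_n.+1), D p ->
    {for p, continuous (iter_partial s f)} /\
    (forall i, derivable (iter_partial s f) p (delta_mx 0 i)).

End Smoothness.

Section Euclidean3.
Variable R : realType.
Implicit Types x y : 'rV[R]_3.

Definition dot x y : R := \sum_i x 0 i * y 0 i.

(* Not `|x|, which on row vectors is the sup norm. *)
Definition enorm x : R := Num.sqrt (dot x x).

(* The indices i + 1 and i + 2 are computed in 'I_3, i.e. modulo 3. *)
Definition cross x y : 'rV[R]_3 :=
  \row_i (x 0 (i + 1) * y 0 (i + 2%:R) - x 0 (i + 2%:R) * y 0 (i + 1)).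

End Euclidean3.

Section Surfaces.
Variable R : realType.
Implicit Types (D : set 'rV[R]_2) (S : set 'rV[R]_3).
Implicit Types (phi : 'rV[R]_2 -> 'rV[R]_3) (lambda H : 'rV[R]_2 -> R).

Definition immersion_on D phi : Prop :=
  forall p, D p -> row_free ('J phi p).

Definition smooth_parameterization D S phi : Prop :=
  [/\ smooth_on D phi, set_bij D S phi & immersion_on D phi].

(* Near each of its points, S is the homeomorphic image of an open subset of
   the plane under a smooth immersion; continuity of the local inverse y is for
   the topology that S inherits from the ambient space. *)
Definition embedded_surface S : Prop :=
  forall q, S q ->
    exists (W : set 'rV[R]_3) (E : set 'rV[R]_2)
           (x : 'rV[R]_2 -> 'rV[R]_3) (y : 'rV[R]_3 -> 'rV[R]_2),
    [/\ open W /\ W q, open E,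
        smooth_parameterization E (S `&` W) x,
        (forall p, E p -> y (x p) = p) &
        {within S `&` W, continuous y}].

(* "Open" in the sense of Riemann surfaces: connected and not compact. *)
Definition open_surface S : Prop :=
  [/\ embedded_surface S, connected S & ~ compact S].

Local Notation d_u := (partial 0).
Local Notation d_v := (partial 1).

Definition conformal_parameterization D S phi lambda : Prop :=
  [/\ smooth_parameterization D S phi,
      smooth_on D (lambda : 'rV[R]_2 -> R^o),
      (forall p, D p -> 0 < lambda p) &
      forall p, D p ->
        [/\ dot (d_u phi p) (d_v phi p) = 0,
            dot (d_u phi p) (d_u phi p) = lambda p ^+ 2 &
            dot (d_v phi p) (d_v phi p) = lambda p ^+ 2]].

Definition unit_normal phi p : 'rV[R]_3 :=
  let N := cross (d_u phi p) (d_v phi p) in (enorm N)^-1 *: N.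

Definition first_form phi p : 'M[R]_2 :=
  \matrix_(i, j) dot (partial i phi p) (partial j phi p).

Definition second_form phi p : 'M[R]_2 :=
  \matrix_(i, j) dot (partial i (partial j phi) p) (unit_normal phi p).

Definition shape_operator phi p : 'M[R]_2 :=
  invmx (first_form phi p) *m second_form phi p.

(* k1 and k2 are the eigenvalues of the shape operator, with multiplicity. *)
Definition principal_curvatures phi p (k1 k2 : R) : Prop :=
  char_poly (shape_operator phi p) = ('X - k1%:P) * ('X - k2%:P).

Definition mean_curvature_on D phi H : Prop :=
  forall p, D p ->
    exists k1 k2, principal_curvatures phi p k1 k2 /\ H p = (k1 + k2) / 2%:R.

End Surfaces.

(* Main.v *)
(* With w = phi' - phi, the identity (phi_uu + phi_vv) = 2 H (phi_u x phi_v),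
   valid in conformal coordinates, gives |w_uu + w_vv| <= C |grad w| locally, so it
   suffices to prove unique continuation for such w.
   In polar coordinates (x, y) = (log radius, angle) around a point near which w
   vanishes, f = (w_u, w_v) satisfies an evolution equation f_x = S f + P, with
   S (a, b) = (- b_y, a_y) symmetric for the L^2 product on circles and |P| <= K |f|.
   For h = <f, f> and d = <S f, f> one finds h' <= 2 d + (K^2 + 1) h and
   d' h - d h' >= - (K^2 / 2) h^2 (Agmon-Nirenberg log-convexity), which forces h to
   stay 0 once it is 0.  So w vanishes on every disc of D around the point, and
   connectedness of D concludes. *)

Require Import Defs.
From mathcomp Require Import all_boot all_order all_algebra.
From mathcomp Require Import all_classical all_reals all_analysis.
From mathcomp Require Import ring lra.
Import Order.TTheory GRing.Theory Num.Theory.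
Import numFieldNormedType.Exports.
Local Open Scope classical_set_scope.
Local Open Scope ring_scope.

Set Implicit Arguments.
Unset Strict Implicit.

(** * Log-convexity *)

(** The data are smooth, not analytic, so power series cannot carry the vanishing of w across D; an
    energy estimate does. The unknown is the gradient because the differential inequality sees
    nothing else of w. The logarithm of the radius is used because S then differentiates in the
    angle alone, with coefficients free of x: S is symmetric even between circles of different
    radii, and d' = 2 <f_x, S f> follows without differentiating S f. The perturbation is P = exp(x)
    (w_uu + w_vv) (cos y, sin y), so K stays bounded as the radius tends to 0. The convexity
    inequality bounds (d / h)' from below. Hence d / h stays bounded above on the way back to the
    last zero of h, and a Gronwall argument starts from that zero. It is written without
    denominators because h may vanish. H is an arbitrary function with no regularity assumed; its
    local boundedness, needed for C, is extracted from the mean curvature equation itself. *)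

Lemma nonincreasing_of_derive (R : realType) (f df : R -> R) (a b : R) :
  a <= b -> (forall x, a <= x <= b -> {for x, continuous f}) ->
  (forall x, a < x < b -> is_derive x 1 f (df x)) ->
  (forall x, a < x < b -> df x <= 0) -> f b <= f a.
Proof.
move=> ab cf fd df0.
have itv x : x \in `]a, b[ -> a < x < b by rewrite in_itv.
apply: (@ler0_derive1_le_cc R f a b); rewrite ?in_itv/= ?lexx ?ab//.
- by move=> x /itv/fd[].
- by move=> x /itv xab; have [_] := fd _ xab; rewrite derive1E => ->; exact: df0.
- apply: continuous_in_subspaceT => x; rewrite inE/= in_itv/=; exact: cf.
Qed.

Lemma is_derive1_continuous (R : realType) (f : R -> R) (x df : R) :
  is_derive x 1 f df -> {for x, continuous f}.
Proof.
by move=> [fd _]; apply/differentiable_continuous; rewrite -derivable1_diffP.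
Qed.

(** After the last zero a of h before x2 the quotient N = d / h has N' >= - C2. So N is bounded
    above on the whole of ]a, x2], and h' <= c h there with a constant c. Since h a = 0, Gronwall
    gives h x2 <= 0. *)
Lemma log_convex_vanish (R : realType) (h d h' d' : R -> R) (l r C1 C2 : R) :
  (forall x, l < x < r -> is_derive x 1 h (h' x)) ->
  (forall x, l < x < r -> is_derive x 1 d (d' x)) ->
  (forall x, l < x < r -> 0 <= h x) ->
  (forall x, l < x < r -> h' x <= 2 * d x + C1 * h x) ->
  (forall x, l < x < r -> - C2 * h x ^+ 2 <= d' x * h x - d x * h' x) ->
  0 <= C2 ->
  forall x1 x2, l < x1 -> x1 <= x2 -> x2 < r -> h x1 = 0 -> h x2 = 0.
Proof.
move=> hd dd h0 hle dle C20 x1 x2 lx1 x12 x2r hx1.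
apply/eqP; rewrite eq_le h0 ?(lt_le_trans lx1)// andbT leNgt; apply/negP => hx2.
(* If h x2 > 0, the supremum of these zeros is the last zero, and h is positive from there to x2. *)
pose A := [set x | x1 <= x <= x2 /\ h x = 0].
have A1 : A x1 by split; rewrite ?lexx.
have supA : has_sup A by split; [exists x1 | exists x2 => x [/andP[]]].
set a := sup A.
have leA y : A y -> y <= a by move=> Ay; exact: sup_upper_bound.
have x1a : x1 <= a by exact: leA.
have ax2 : a <= x2 by apply: ge_sup => [|x [/andP[]]//]; exists x1.
have lr x : x1 <= x -> x <= x2 -> l < x < r.
  by move=> x1x xx2; rewrite (lt_le_trans lx1 x1x) (le_lt_trans xx2 x2r).
have hc x : x1 <= x -> x <= x2 -> {for x, continuous h}.
  by move=> x1x xx2; apply: is_derive1_continuous (hd _ (lr _ x1x xx2)).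
have ha : h a = 0.
  apply/eqP; rewrite eq_le h0 ?lr// andbT leNgt; apply/negP => ha.
  have /nbhs_ballP[e /= e0 be] : nbhs a [set x | 0 < h x].
    exact: (cvgr_gt _ (hc _ x1a ax2) _ ha).
  have [t At] := sup_adherent e0 supA.
  rewrite -/a => at_.
  have ta : t <= a by exact: leA.
  have /be/= : ball a e t by rewrite /ball/= ger0_norm ?subr_ge0//; lra.
  by rewrite At.2 ltxx.
have hpos x : a < x -> x <= x2 -> 0 < h x.
  move=> ax xx2; rewrite lt_neqAle h0 ?lr ?(le_trans x1a (ltW ax))// andbT.
  apply/negP => /eqP hx; have Ax : A x.
    by split; rewrite ?xx2 ?andbT ?(le_trans x1a (ltW ax)).
  by have := leA _ Ax; rewrite leNgt ax.
pose N x := d x * (h x)^-1.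
have Nd x : a < x -> x <= x2 ->
    is_derive x 1 N ((d' x * h x - d x * h' x) / h x ^+ 2).
  move=> ax xx2; have hx := hpos _ ax xx2.
  have xlr := lr _ (le_trans x1a (ltW ax)) xx2.
  have := dd _ xlr; have := hd _ xlr => hdx ddx.
  have := is_deriveV (lt0r_neq0 hx) hdx => hV.
  have := is_deriveM ddx hV.
  move/is_derive_eq; apply; rewrite /GRing.scale/=.
  by field; rewrite lt0r_neq0.
(* N y + C2 y is nondecreasing, so N x <= N x2 + C2 (x2 - x); replacing x by x1 makes the bound
   uniform as x approaches a. *)
pose M := N x2 + C2 * (x2 - x1).
have NM x : a < x -> x <= x2 -> N x <= M.
  move=> ax xx2.
  pose dg y := - ((d' y * h y - d y * h' y) / h y ^+ 2) - C2.
  have Ng y : x <= y <= x2 -> is_derive y 1 (fun y => - N y - C2 * y) (dg y).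
    move=> /andP[xy yx2]; have Ny := Nd _ (lt_le_trans ax xy) yx2.
    apply: is_derive_eq; rewrite /dg; by rewrite /GRing.scale/= mulr1.
  have := @nonincreasing_of_derive R (fun y => - N y - C2 * y) dg _ _ xx2.
  have H1 y : x <= y <= x2 -> {for y, continuous (fun y => - N y - C2 * y)}.
    by move=> /Ng; exact: is_derive1_continuous.
  have H2 y : x < y < x2 -> is_derive y 1 (fun y => - N y - C2 * y) (dg y).
    by move=> /andP[xy yx2]; apply: Ng; rewrite !ltW.
  have H3 y : x < y < x2 -> dg y <= 0.
    move=> /andP[xy yx2]; have hy := hpos _ (lt_trans ax xy) (ltW yx2).
    have := dle y (lr _ (le_trans x1a (ltW (lt_trans ax xy))) (ltW yx2)).
    rewrite /dg => le; rewrite lerBlDr add0r lerNl ler_pdivlMr ?exprn_gt0//.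
  move=> /(_ H1 H2 H3) le.
  rewrite /M; have : C2 * (x2 - x) <= C2 * (x2 - x1).
    by apply: ler_wpM2l => //; lra.
  lra.
(* From h' <= 2 d + C1 h and d = N h <= M h; the exponential factor then makes g nonincreasing from
   the zero a. *)
pose c := 2 * M + C1.
pose g x := h x * expR (- (c * x)).
pose dg x := (h' x - c * h x) * expR (- (c * x)).
have gd x : x1 <= x -> x <= x2 -> is_derive x 1 g (dg x).
  move=> x1x xx2; have hdx := hd _ (lr _ x1x xx2).
  apply: is_derive_eq; rewrite /dg /GRing.scale/=; ring.
suff : g x2 <= g a.
  by rewrite /g ha mul0r leNgt mulr_gt0 ?expR_gt0.
apply: (@nonincreasing_of_derive R g dg) => //.
- move=> x /andP[ax xx2].
  by apply: is_derive1_continuous (gd _ _ xx2); exact: le_trans ax.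
- by move=> x /andP[ax xx2]; apply: gd; rewrite ?(ltW xx2)// (le_trans x1a (ltW ax)).
- move=> x /andP[ax xx2]; rewrite /dg mulr_le0_ge0 ?expR_ge0// subr_le0 /c.
  have hx := hpos _ ax (ltW xx2).
  apply: le_trans (hle _ (lr _ (le_trans x1a (ltW ax)) (ltW xx2))) _.
  have : N x * h x <= M * h x by rewrite ler_wpM2r ?(ltW hx)// NM// ltW.
  rewrite /N mulfVK ?lt0r_neq0// => le; lra.
Qed.

(** * Integration over a circle *)

Section AngularIntegral.
Context {R : realType}.
Local Notation mu := (@lebesgue_measure R).
Local Notation circ := (`[0, pi *+ 2]%classic : set R).

Definition angular_integral (g : R -> R) : R := (\int[mu]_(y in circ) g y)%R.

Local Notation J := angular_integral.

Let circ_gt0 : 0 < pi *+ 2 :> R. Proof. by rewrite pmulrn_rgt0// pi_gt0. Qed.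

Lemma angular_integrable (g : R -> R) :
  continuous g -> mu.-integrable circ (EFin \o g).
Proof.
move=> gc; apply: continuous_compact_integrable; first exact: segment_compact.
exact: continuous_subspaceT.
Qed.

Lemma angular_integralD (f g : R -> R) : continuous f -> continuous g ->
  J (fun y => f y + g y) = J f + J g.
Proof. by move=> fc gc; rewrite /J RintegralD//; exact: angular_integrable. Qed.

Lemma angular_integralZ (c : R) (g : R -> R) : continuous g ->
  J (fun y => c * g y) = c * J g.
Proof. by move=> gc; rewrite /J RintegralZl//; exact: angular_integrable. Qed.

Lemma angular_integral_ge0 (g : R -> R) : (forall y, 0 <= g y) -> 0 <= J g.
Proof. by move=> g0; apply: Rintegral_ge0 => y _. Qed.

Lemma angular_integral_le (f g : R -> R) : continuous f -> continuous g ->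
  (forall y, f y <= g y) -> J f <= J g.
Proof.
by move=> fc gc fg; apply: le_Rintegral => //; exact: angular_integrable.
Qed.

(** Applied to a sum of products, this is integration by parts on the circle, where periodicity
    cancels the boundary terms. *)
Lemma angular_integral_derive (F f : R -> R) :
  (forall y : R, is_derive y 1 F (f y)) -> continuous f -> F (pi *+ 2) = F 0 ->
  J f = 0.
Proof.
move=> Ff fc Fper; rewrite /J /Rintegral (continuous_FTC2 circ_gt0 (F := F)).
- by rewrite Fper subee.
- exact: continuous_subspaceT.
- have Fc : continuous F by move=> y; exact: is_derive1_continuous (Ff y).
  split; first by move=> y _; case: (Ff y).
  + exact/cvg_at_right_filter/Fc.
  + exact/cvg_at_left_filter/Fc.
- by move=> y _; rewrite derive1E; case: (Ff y).
Qed.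

Lemma angular_integral_eq0 (g : R -> R) : continuous g ->
  (forall y, 0 <= g y) -> J g = 0 -> forall y, 0 <= y <= pi *+ 2 -> g y = 0.
Proof.
move=> gc g0 Jg y0 /andP[y00 y01]; apply/eqP; rewrite eq_le g0 andbT leNgt.
apply/negP => gy0.
have /nbhs_ballP[e /= e0 be] : nbhs y0 [set y | g y0 / 2 < g y].
  by apply: (cvgr_gt _ (gc y0)); lra.
(* Clipping to the circle covers y0 equal to an endpoint; the interval keeps positive length. *)
pose u := Num.max 0 (y0 - e / 2); pose v := Num.min (pi *+ 2) (y0 + e / 2).
have uv : u < v.
  have := circ_gt0 => c0.
  by rewrite gt_max !lt_min; apply/andP; split; apply/andP; split; lra.
have u0 : 0 <= u by rewrite /u le_max lexx.
have v1 : v <= pi *+ 2 by rewrite /v ge_min lexx.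
have gle y : u <= y -> y <= v -> g y0 / 2 <= g y.
  rewrite /u /v ge_max le_min => /andP[_ h1] /andP[_ h2]; apply/ltW/be.
  rewrite /ball/= ltr_norml; apply/andP; split; lra.
have sub : `[u, v] `<=` circ.
  by move=> y; rewrite /= !in_itv/= => /andP[uy yv]; rewrite (le_trans u0)//= (le_trans yv).
have ig : mu.-integrable circ (EFin \o g) := angular_integrable gc.
have iguv : mu.-integrable `[u, v] (EFin \o g) by exact: integrableS ig.
have : (\int[mu]_(y in `[u, v]) (g y0 / 2) <= \int[mu]_(y in `[u, v]) g y)%R.
  apply: le_Rintegral => //.
    apply: continuous_compact_integrable; first exact: segment_compact.
    by apply: continuous_subspaceT => ?; exact: cvg_cst.
  by move=> y; rewrite /= in_itv/= => /andP[]; exact: gle.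
rewrite Rintegral_cst//= lebesgue_measure_itv/= lte_fin uv -EFinD/=.
have : (\int[mu]_(y in `[u, v]) g y <= J g)%R.
  rewrite /J /Rintegral fine_le//.
  - by apply: integrable_fin_num.
  - by apply: integrable_fin_num.
  apply: ge0_subset_integral => //=; first exact: (measurable_int mu).
  by move=> y _; rewrite lee_fin.
rewrite Jg => h1 h2; have := le_trans h2 h1; rewrite leNgt => /negP; apply.
by rewrite mulr_gt0 ?subr_gt0// divr_gt0.
Qed.

End AngularIntegral.

(** * Differentiation under the angular integral *)

Lemma derive_bound_lipschitz (R : realType) (f df : R -> R) (l r M : R) :
  (forall x : R, l < x < r -> is_derive x 1 f (df x)) ->
  (forall x, l < x < r -> `|df x| <= M) ->
  forall x y, l < x < r -> l < y < r -> `|f x - f y| <= M * `|x - y|.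
Proof.
move=> fd dfM x y; wlog yx : x y / y <= x => [hw xlr ylr|].
  have [yx|/ltW xy] := leP y x; first exact: hw.
  by rewrite distrC [`|x - y|]distrC; exact: hw.
move=> /andP[lx xr] /andP[ly yr].
have sub z : y <= z -> z <= x -> l < z < r.
  by move=> yz zx; rewrite (lt_le_trans ly)//= (le_lt_trans zx).
have [| |z] := @MVT_segment R f df y x yx.
- move=> z; rewrite in_itv/= => /andP[yz zx]; apply: fd; apply: sub; exact: ltW.
- apply: continuous_in_subspaceT => z; rewrite inE/= in_itv/= => /andP[yz zx].
  by apply: is_derive1_continuous (fd _ _); exact: sub.
rewrite in_itv/= => /andP[yz zx] ->.
by rewrite normrM ler_wpM2r// dfM// sub.
Qed.

Lemma near_open_interval (R : realType) (l r x : R) :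
  l < x < r -> \forall z \near x, l < z < r.
Proof.
move=> xlr; have := @near_in_itvoo R l r x; rewrite in_itv/= => /(_ xlr).
by apply: filterS => z; rewrite in_itv.
Qed.

Section DeriveUnderIntegral.
Context {R : realType}.
Variables (l r : R).
Local Notation J := angular_integral.
Local Notation mu := (@lebesgue_measure R).

Lemma continuous_angular_integral (M : R) (f : R -> R -> R) :
  (forall x, l < x < r -> continuous (f x)) ->
  (forall x y, l < x < r -> {for x, continuous (f ^~ y)}) ->
  (forall x y, l < x < r -> `|f x y| <= M) ->
  forall x, l < x < r -> {for x, continuous (fun x => J (f x))}.
Proof.
move=> fy fx fM x xlr.
have I z : `]l, r[%classic z -> l < z < r by rewrite /= in_itv.
have := @continuity_under_integral R _ _ mu f `[0, pi *+ 2]%classic _ l r _ _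
  (cst M) _ _ x.
apply => //.
- by move=> z /I zlr; apply: angular_integrable; exact: fy.
- by apply: aeW => y _ z; rewrite inE => /I; exact: fx.
- by apply: angular_integrable => ?; exact: cvg_cst.
- by move=> z /I zlr; apply: aeW => y _; exact: fM.
- by rewrite inE/= in_itv.
Qed.

(** The factor u x - u x0 vanishes at x0, so v need only be continuous in x. The difference quotient
    of u, completed by du at x0, is continuous and bounded by M, which reduces the claim to
    continuity under the integral sign. *)
Lemma is_derive_angular_integral (M : R) (u du v : R -> R -> R) :
  (forall x y : R, l < x < r -> is_derive x 1 (u ^~ y) (du x y)) ->
  (forall x, l < x < r -> continuous (u x)) ->
  (forall x, l < x < r -> continuous (du x)) ->
  (forall x, l < x < r -> continuous (v x)) ->
  (forall x y, l < x < r -> {for x, continuous (v ^~ y)}) ->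
  (forall x y, l < x < r -> `|du x y| <= M) ->
  (forall x y, l < x < r -> `|v x y| <= M) ->
  forall x0 : R, l < x0 < r ->
  is_derive x0 1 (fun x => J (fun y => (u x y - u x0 y) * v x y))
    (J (fun y => du x0 y * v x0 y)).
Proof.
move=> ud uc duc vc vx duM vM x0 x0lr.
pose q x y := if x == x0 then du x0 y else (u x y - u x0 y) / (x - x0).
pose F x := J (fun y => (u x y - u x0 y) * v x y).
have F0 : F x0 = 0.
  rewrite /F (_ : (fun y => _) = cst 0).
    by rewrite /J Rintegral_cst// mul0r.
  by apply/funext => y; rewrite subrr mul0r.
have qc x : l < x < r -> continuous (q x).
  move=> xlr; rewrite /q; case: eqP => _; first exact: duc.
  move=> y; apply: cvgM; last exact: cvg_cst.
  by apply: cvgB; exact: uc.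
have qx x y : l < x < r -> {for x, continuous (q ^~ y)}.
  move=> xlr.
  (* The Caratheodory factor of u at x0 is the completed quotient q itself, which gives its
     continuity at x0. *)
  have [g [gE gc gx0]] := (is_derive1_caratheodory _ _ _).1 (ud _ y x0lr).
  have qg : q ^~ y = g.
    apply/funext => z; rewrite /q -gx0; case: eqVneq => [->//|zx0].
    by rewrite gE mulfK// subr_eq0.
  have [->|xx0] := eqVneq x x0; first by rewrite qg.
  have : {for x, continuous (fun x => (u x y - u x0 y) / (x - x0))}.
    apply: cvgM.
      apply: cvgB; last exact: cvg_cst.
      exact: is_derive1_continuous (ud _ y xlr).
    apply: cvgV; first by rewrite subr_eq0.
    by apply: cvgB; [exact: cvg_id|exact: cvg_cst].
  rewrite /continuous_at [X in _ --> X -> _](_ : _ = q x y); last first.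
    by rewrite /q (negbTE xx0).
  apply: cvg_trans; apply: near_eq_cvg.
  have : \forall z \near x, z - x0 != 0.
    have cB : (fun z => z - x0) @ x --> x - x0.
      by apply: cvgB; [exact: cvg_id|exact: cvg_cst].
    by apply: (cvgr_neq0 _ cB); rewrite subr_eq0.
  by apply: filterS => z; rewrite subr_eq0 => zx0; rewrite /q (negbTE zx0).
have M0 : 0 <= M by apply: le_trans (normr_ge0 _) (vM x0 0 x0lr).
have qM x y : l < x < r -> `|q x y| <= M.
  move=> xlr; rewrite /q; case: eqVneq => [_|xx0]; first exact: duM.
  rewrite normrM normfV ler_pdivrMr ?normr_gt0 ?subr_eq0//.
  apply: (@derive_bound_lipschitz R (u ^~ y) (du ^~ y) l r M) => // z zlr.
  exact: duM.
apply/is_derive1_caratheodory.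
pose G x := J (fun y => q x y * v x y).
exists (fun x => if x == x0 then G x0 else (F x - F x0) / (x - x0)); split.
- move=> z; case: eqVneq => [->|zx0]; first by rewrite !subrr mulr0.
  by rewrite divfK// subr_eq0.
- have Gc : {for x0, continuous G}.
    apply: (@continuous_angular_integral (M * M) (fun x y => q x y * v x y)) => //.
    + by move=> x xlr y; apply: cvgM; [exact: qc|exact: vc].
    + by move=> x y xlr; apply: cvgM; [exact: qx|exact: vx].
    + by move=> x y xlr; rewrite normrM ler_pM//; [exact: qM|exact: vM].
  rewrite /prop_for /continuous_at /= eqxx.
  apply: cvg_trans Gc; apply: near_eq_cvg.
  have : \forall z \near x0, l < z < r.
    exact: near_open_interval.
  apply: filterS => z zlr; case: eqVneq => [->//|zx0].
  rewrite F0 subr0 mulrC /F -angular_integralZ; last first.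
    by move=> y; apply: cvgM; [apply: cvgB; exact: uc|exact: vc].
  rewrite /G; congr J; apply/funext => y.
  by rewrite /q (negbTE zx0); ring.
- by rewrite eqxx /G /q eqxx.
Qed.
End DeriveUnderIntegral.

(** * L^2 products on circles and the energy estimate *)

Section Energy.
Context {R : realType} {m : nat}.
Implicit Types u v w : 'I_m -> R -> R.
Local Notation J := angular_integral.

Definition angular_dot u v : R := J (fun y => \sum_(i < m) u i y * v i y).

Local Notation ip := angular_dot.

Let continuous_dot u v : (forall i, continuous (u i)) ->
  (forall i, continuous (v i)) ->
  continuous (fun y => \sum_(i < m) u i y * v i y).
Proof.
move=> uc vc; apply: continuous_big => [|i _ y]; first exact: add_continuous.
by apply: cvgM; [exact: uc|exact: vc].
Qed.

Lemma angular_dotC u v : ip u v = ip v u.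
Proof. by congr J; apply/funext => y; apply: eq_bigr => i _; rewrite mulrC. Qed.

Lemma angular_dotDl u v w : (forall i, continuous (u i)) ->
  (forall i, continuous (v i)) -> (forall i, continuous (w i)) ->
  ip (fun i y => u i y + v i y) w = ip u w + ip v w.
Proof.
move=> uc vc wc; rewrite /ip -angular_integralD; [|exact: continuous_dot..].
congr J; apply/funext => y; rewrite -big_split/=.
by apply: eq_bigr => i _; rewrite mulrDl.
Qed.

Lemma angular_dotZl (c : R) u v : (forall i, continuous (u i)) ->
  (forall i, continuous (v i)) -> ip (fun i y => c * u i y) v = c * ip u v.
Proof.
move=> uc vc; rewrite /ip -angular_integralZ; last exact: continuous_dot.
congr J; apply/funext => y; rewrite mulr_sumr.
by apply: eq_bigr => i _; rewrite mulrA.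
Qed.

Lemma angular_dot_ge0 u : 0 <= ip u u.
Proof.
by apply: angular_integral_ge0 => y; apply: sumr_ge0 => i _; rewrite -expr2 sqr_ge0.
Qed.

Let continuousZ (c : R) u : (forall i, continuous (u i)) ->
  forall i, continuous (fun y => c * u i y).
Proof. by move=> uc i y; apply: cvgM; [exact: cvg_cst|exact: uc]. Qed.

Let continuousD u v : (forall i, continuous (u i)) ->
  (forall i, continuous (v i)) -> forall i, continuous (fun y => u i y + v i y).
Proof. by move=> uc vc i y; apply: cvgD; [exact: uc|exact: vc]. Qed.

Lemma angular_dot_sqr (c : R) u v : (forall i, continuous (u i)) ->
  (forall i, continuous (v i)) ->
  ip (fun i y => u i y + c * v i y) (fun i y => u i y + c * v i y) =
  ip u u + 2 * c * ip u v + c ^+ 2 * ip v v.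
Proof.
move=> uc vc; have cvc := @continuousZ c _ vc; have wc := continuousD uc cvc.
rewrite angular_dotDl// angular_dotZl//.
rewrite [ip u _]angular_dotC [ip v _]angular_dotC.
rewrite !angular_dotDl// !angular_dotZl// [ip v u]angular_dotC; ring.
Qed.

Lemma angular_dot_CauchySchwarz u v : (forall i, continuous (u i)) ->
  (forall i, continuous (v i)) -> ip u v ^+ 2 <= ip u u * ip v v.
Proof.
move=> uc vc.
have sq c : 0 <= ip u u + 2 * c * ip u v + c ^+ 2 * ip v v.
  by rewrite -angular_dot_sqr// angular_dot_ge0.
have := angular_dot_ge0 v; rewrite le_eqVlt => /orP[/eqP vv|vv].
  rewrite -vv mulr0; have [->|uv] := eqVneq (ip u v) 0; first by rewrite expr0n.
  (* With <v, v> = 0 the quadratic in c is affine; a nonzero slope would let it take the value -1,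
     which this c achieves. *)
  have := sq (- (ip u u + 1) / (2 * ip u v)); rewrite -vv mulr0 addr0.
  rewrite (_ : 2 * _ * _ = - (ip u u + 1)); last by field.
  by rewrite opprD addrA subrr add0r leNgt oppr_lt0 ltr01.
(* The minimizer of the quadratic. *)
have := sq (- ip u v / ip v v).
rewrite (_ : _ + _ = ip u u - ip u v ^+ 2 / ip v v); last by field; rewrite gt_eqF.
by rewrite subr_ge0 ler_pdivrMr.
Qed.

Lemma angular_integral_sum (g : 'I_m -> R -> R) : (forall i, continuous (g i)) ->
  J (fun y => \sum_(i < m) g i y) = \sum_(i < m) J (g i).
Proof.
move=> gc; elim: (index_enum _) => [|i s ih].
  rewrite big_nil (_ : (fun y => _) = cst 0); first by rewrite /J Rintegral_cst// mul0r.
  by apply/funext => y; rewrite big_nil.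
rewrite big_cons -ih -angular_integralD//.
  by congr J; apply/funext => y; rewrite big_cons.
by apply: continuous_big => //; exact: add_continuous.
Qed.

(* By symmetry <s x, f x> - <s x0, f x0> = <f x - f x0, s x + s x0>, so that no
   derivative of s is needed. *)
Lemma is_derive_angular_dot (f df s : 'I_m -> R -> R -> R) (l r M : R) :
  (forall i (x y : R), l < x < r -> is_derive x 1 (f i ^~ y) (df i x y)) ->
  (forall i x, l < x < r -> continuous (f i x)) ->
  (forall i x, l < x < r -> continuous (df i x)) ->
  (forall i x, l < x < r -> continuous (s i x)) ->
  (forall i x y, l < x < r -> {for x, continuous (s i ^~ y)}) ->
  (forall i x y, l < x < r -> `|df i x y| <= M) ->
  (forall i x y, l < x < r -> `|s i x y| <= M) ->
  (forall x z, l < x < r -> l < z < r ->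
    ip (s ^~ x) (f ^~ z) = ip (f ^~ x) (s ^~ z)) ->
  forall x0 : R, l < x0 < r ->
  is_derive x0 1 (fun x => ip (s ^~ x) (f ^~ x)) (2 * ip (df ^~ x0) (s ^~ x0)).
Proof.
move=> fd fc dfc sc sx dfM sM sym x0 x0lr.
pose v i x y := s i x y + s i x0 y.
pose g i x := J (fun y => (f i x y - f i x0 y) * v i x y).
have gd i : is_derive x0 1 (g i) (J (fun y => df i x0 y * v i x0 y)).
  apply: (@is_derive_angular_integral R l r (M + M) (f i) (df i) (v i)) => //.
  - exact: fc.
  - exact: dfc.
  - by move=> x xlr y; apply: cvgD; exact: sc.
  - by move=> x y xlr; apply: cvgD; [exact: sx|exact: cvg_cst].
  - move=> x y xlr; rewrite (le_trans (dfM i x y xlr))// lerDl.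
    exact: le_trans (normr_ge0 _) (dfM i x y xlr).
  - by move=> x y xlr; rewrite (le_trans (ler_normD _ _))// lerD// sM.
pose F x := ip (s ^~ x0) (f ^~ x0) + (\sum_(i < m) g i) x.
apply: (@near_eq_is_derive _ _ _ F).
  apply: filterS (near_open_interval x0lr) => x xlr.
  rewrite /F fct_sumE /g -angular_integral_sum; last first.
    move=> i y; apply: cvgM; first by apply: cvgB; exact: fc.
    by apply: cvgD; exact: sc.
  have fcx := fc ^~ x ^~ xlr; have fc0 := fc ^~ x0 ^~ x0lr.
  have scx := sc ^~ x ^~ xlr; have sc0 := sc ^~ x0 ^~ x0lr.
  have -> : J (fun y => \sum_(i < m) (f i x y - f i x0 y) * v i x y) =
      ip (fun i y => f i x y + (-1) * f i x0 y) (fun i y => s i x y + s i x0 y).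
    by congr J; apply/funext => y; apply: eq_bigr => i _; rewrite mulN1r.
  have fN := @continuousZ (-1) _ fc0; have sD := continuousD scx sc0.
  rewrite angular_dotDl// angular_dotZl// ![ip _ (fun i y => _ + _)]angular_dotC.
  rewrite !angular_dotDl// [ip (s ^~ x) (f ^~ x0)]sym// [ip (f ^~ x) _]angular_dotC.
  ring.
apply: is_derive_eq; rewrite add0r /v.
rewrite -angular_integral_sum; last first.
  by move=> i y; apply: cvgM; [exact: dfc|apply: cvgD; exact: sc].
rewrite mul1r -[LHS]/(ip (df ^~ x0) (fun i y => s i x0 y + s i x0 y)).
rewrite angular_dotC angular_dotDl; [|by move=> i; auto..].
by rewrite angular_dotC; ring.
Qed.

End Energy.

(** The family [s] stands for S f: symmetry between any two radii is all that is asked of the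
    operator. [K] bounds squares, so it is the K^2 of the overview. The bound [M] serves the
    dominated convergence behind the derivatives of h and d. The conclusion is confined to one
    period because the integral sees nothing else. *)
Lemma evolution_vanish (R : realType) (m : nat)
    (f df s : 'I_m -> R -> R -> R) (l r M K : R) :
  (forall i (x y : R), l < x < r -> is_derive x 1 (f i ^~ y) (df i x y)) ->
  (forall i x, l < x < r -> continuous (f i x)) ->
  (forall i x, l < x < r -> continuous (df i x)) ->
  (forall i x, l < x < r -> continuous (s i x)) ->
  (forall i x y, l < x < r -> {for x, continuous (s i ^~ y)}) ->
  (forall i x y, l < x < r -> `|f i x y| <= M) ->
  (forall i x y, l < x < r -> `|df i x y| <= M) ->
  (forall i x y, l < x < r -> `|s i x y| <= M) ->
  (forall x z, l < x < r -> l < z < r ->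
    angular_dot (s ^~ x) (f ^~ z) = angular_dot (f ^~ x) (s ^~ z)) ->
  0 <= K ->
  (forall x y, l < x < r ->
    \sum_(i < m) (df i x y - s i x y) ^+ 2 <= K * \sum_(i < m) f i x y ^+ 2) ->
  forall x1 x2, l < x1 -> x1 <= x2 -> x2 < r ->
  (forall i y, f i x1 y = 0) ->
  forall i y, 0 <= y <= pi *+ 2 -> f i x2 y = 0.
Proof.
move=> fd fc dfc sc sx fM dfM sM sym K0 dfsK x1 x2 lx1 x12 x2r f0.
pose ip := @angular_dot R m.
pose h x := ip (f ^~ x) (f ^~ x).
pose d x := ip (s ^~ x) (f ^~ x).
pose h' x := 2 * ip (df ^~ x) (f ^~ x).
pose d' x := 2 * ip (df ^~ x) (s ^~ x).
have hd x : l < x < r -> is_derive x 1 h (h' x).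
  move=> xlr; apply: (@is_derive_angular_dot R m f df f l r M) => //.
  by move=> i z y zlr; apply: is_derive1_continuous (fd _ _ _ zlr).
have dd x : l < x < r -> is_derive x 1 d (d' x).
  by move=> xlr; apply: (@is_derive_angular_dot R m f df s l r M).
have hs x : 0 <= h x by exact: angular_dot_ge0.
have cts x : l < x < r -> [/\ forall i, continuous (f i x),
    forall i, continuous (df i x) & forall i, continuous (s i x)].
  by move=> xlr; split => i; [exact: fc|exact: dfc|exact: sc].
(* Polarization: 4 <df, s> = |q|^2 - |p|^2 and 4 <df, f> d = <q, f>^2 - <p, f>^2. In d' h - d h' the
   q-terms are nonnegative by Cauchy-Schwarz, and the p-terms are controlled by |p|^2 <= K h. *)
pose p x := fun i y => df i x y + (-1) * s i x y.
pose q x := fun i y => df i x y + 1 * s i x y.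
have ctsZ (c : R) (u : 'I_m -> R -> R) : (forall i, continuous (u i)) ->
    forall i, continuous (fun y => c * u i y).
  by move=> uc i y; apply: cvgM; [exact: cvg_cst|exact: uc].
have ctsD (u v : 'I_m -> R -> R) : (forall i, continuous (u i)) ->
    (forall i, continuous (v i)) -> forall i, continuous (fun y => u i y + v i y).
  by move=> uc vc i y; apply: cvgD; [exact: uc|exact: vc].
have ppK x : l < x < r -> ip (p x) (p x) <= K * h x.
  move=> xlr; have [fcx dcx scx] := cts _ xlr.
  rewrite /h -angular_dotZl//; have pcx := ctsD _ _ dcx (ctsZ (-1) _ scx).
  apply: angular_integral_le.
  - apply: continuous_big => [|i _ y]; first exact: add_continuous.
    by apply: cvgM; exact: pcx.
  - apply: continuous_big => [|i _ y]; first exact: add_continuous.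
    by apply: cvgM; [exact: (ctsZ K _ fcx)|exact: fcx].
  move=> y; have := dfsK x y xlr; rewrite mulr_sumr.
  by under eq_bigr do rewrite -mulN1r expr2; under [leRHS]eq_bigr do rewrite expr2 mulrA.
have qf x : l < x < r -> ip (q x) (f ^~ x) = ip (df ^~ x) (f ^~ x) + d x.
  move=> xlr; have [fcx dcx scx] := cts _ xlr.
  by rewrite /ip /q angular_dotDl// ?angular_dotZl ?mul1r//; exact: ctsZ.
have pf x : l < x < r -> ip (p x) (f ^~ x) = ip (df ^~ x) (f ^~ x) - d x.
  move=> xlr; have [fcx dcx scx] := cts _ xlr.
  by rewrite /ip /p angular_dotDl// ?angular_dotZl ?mulN1r//; exact: ctsZ.
have h2 : h x2 = 0.
  apply: (@log_convex_vanish R h d h' d' l r (K + 1) (K / 2) _ _ _ _ _ _ x1) => //.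
  - move=> x xlr; have [fcx dcx scx] := cts _ xlr.
    have pcx := ctsD _ _ dcx (ctsZ (-1) _ scx).
    (* Nonnegativity of |p - f|^2 gives 2 <p, f> <= |p|^2 + h <= (K + 1) h. *)
    have := angular_dot_ge0 (fun i y => p x i y + (-1) * f i x y).
    rewrite angular_dot_sqr// -/ip -/(h x) pf//.
    by have := ppK x xlr; rewrite /h'; lra.
  - move=> x xlr; have [fcx dcx scx] := cts _ xlr.
    have pcx := ctsD _ _ dcx (ctsZ (-1) _ scx).
    have qcx := ctsD _ _ dcx (ctsZ 1 _ scx).
    have := ppK x xlr; have := angular_dot_CauchySchwarz qcx fcx.
    rewrite -/ip -/(h x) -/(q x) qf// /p /q /ip !angular_dot_sqr// -/ip /h' /d'.
    have := hs x; move: (h x) (d x) (ip _ (f ^~ x)) (ip (df ^~ x) (df ^~ x))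
      (ip _ (s ^~ x)) (ip (s ^~ x) (s ^~ x)) => H D A B C E H0 CS PK.
    (* This is |p|^2 h <= K h^2; the remaining slack is the square <p, f>^2 = (A - D)^2. *)
    have : (B + 2 * -1 * C + (-1) ^+ 2 * E) * H <= K * H * H by rewrite ler_wpM2r.
    have := sqr_ge0 (A - D).
    lra.
  - lra.
  - rewrite /h /ip /angular_dot (_ : (fun y => _) = cst 0).
      by rewrite /angular_integral Rintegral_cst// mul0r.
    by apply/funext => y; rewrite big1// => i _; rewrite f0 mul0r.
move=> i y y02.
have fc2 i' : continuous (f i' x2) by apply: fc; rewrite (lt_le_trans lx1 x12).
have := @angular_integral_eq0 R (fun y => \sum_(i < m) f i x2 y * f i x2 y) _ _ h2 y y02.
have c2 : continuous (fun y => \sum_(i < m) f i x2 y * f i x2 y).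
  apply: continuous_big => [|j _ z]; first exact: add_continuous.
  by apply: cvgM; exact: fc2.
have ge y' : 0 <= \sum_(i < m) f i x2 y' * f i x2 y'.
  by apply: sumr_ge0 => j _; rewrite -expr2 sqr_ge0.
move=> /(_ c2 ge) /eqP; rewrite psumr_eq0 => [/allP/(_ i)|j _].
  by rewrite mem_index_enum => /(_ isT)/=; rewrite mulf_eq0 orbb => /eqP.
by rewrite -expr2 sqr_ge0.
Qed.

(** * Calculus in the plane *)

(** Distances to a replace intervals, so that increments of either sign are treated alike inside a
    ball centred at a. *)
Lemma mean_value (R : realType) (g dg : R -> R) (a b : R) :
  (forall t : R, `|t - a| <= `|b - a| -> is_derive t 1 g (dg t)) ->
  exists2 c, `|c - a| <= `|b - a| & g b - g a = (b - a) * dg c.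
Proof.
have itvc (x y z : R) : (z \in `[x, y]) = (x <= z <= y) by rewrite in_itv.
have itvo (x y z : R) : (z \in `]x, y[) = (x < z < y) by rewrite in_itv.
move=> gd; have [ab|/ltW ba] := leP a b.
- have [| |c] := @MVT_segment R g dg a b ab.
  + move=> t; rewrite itvo => /andP[at_ tb]; apply: gd.
    by rewrite !ger0_norm; lra.
  + apply: continuous_in_subspaceT => t; rewrite inE/= itvc => /andP[at_ tb].
    by apply: is_derive1_continuous (gd _ _); rewrite !ger0_norm; lra.
  rewrite itvc => /andP[ac cb] ->; exists c; last by rewrite mulrC.
  by rewrite !ger0_norm; lra.
- have [| |c] := @MVT_segment R g dg b a ba.
  + move=> t; rewrite itvo => /andP[bt ta]; apply: gd.
    by rewrite !ler0_norm; lra.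
  + apply: continuous_in_subspaceT => t; rewrite inE/= itvc => /andP[bt ta].
    by apply: is_derive1_continuous (gd _ _); rewrite !ler0_norm; lra.
  rewrite itvc => /andP[bc ca] gab; exists c; first by rewrite !ler0_norm; lra.
  by rewrite -[LHS]opprB gab; ring.
Qed.

Lemma ord2P (i : 'I_2) : i = 0 \/ i = 1.
Proof. by case: i => [[|[|]]]// ?; [left|right]; exact: val_inj. Qed.

Lemma subrACA (Z : zmodType) (a b c d : Z) : a - b - (c - d) = a - c - (b - d).
Proof. by rewrite !opprB !addrA addrAC [RHS]addrAC; congr (_ + _); rewrite addrAC. Qed.

Section PlaneCalculus.
Context {R : realType}.
Local Notation V := 'rV[R]_2.
Local Notation e i := (delta_mx 0 i : V).

Definition pt (a b : R) : V := \row_i (if i == 0 then a else b).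

Lemma pt_eta (p : V) : p = pt (p 0 0) (p 0 1).
Proof.
by apply/rowP => i; rewrite mxE; case: (ord2P i) => ->.
Qed.

Lemma ball_pt (a b c d r : R) :
  ball (pt a b) r (pt c d) <-> `|a - c| < r /\ `|b - d| < r.
Proof.
split=> [[_ h]|[h0 h1]].
  by have := h 0 0; have := h 0 1; rewrite !mxE/= /ball/=.
split=> [|i j]; first exact: le_lt_trans (normr_ge0 _) h0.
by rewrite !mxE /ball/=; case: eqP.
Qed.

Lemma is_derive_pt (f : V -> R) (a b : R) :
  (derivable f (pt a b) (e 0) ->
    is_derive a 1 (fun t => f (pt t b)) (partial 0 (f : V -> R^o) (pt a b))) /\
  (derivable f (pt a b) (e 1) ->
    is_derive b 1 (fun t => f (pt a t)) (partial 1 (f : V -> R^o) (pt a b))).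
Proof.
split=> fd.
- have E : (fun h : R => h^-1 *: (((fun t => f (pt t b)) \o shift a) (h *: 1) -
      f (pt a b))) =
     (fun h : R => h^-1 *: ((f \o shift (pt a b)) (h *: e 0) - f (pt a b))).
    apply/funext => h /=; congr (_ *: (f _ - _)); apply/rowP => i; rewrite !mxE.
    by case: (ord2P i) => ->; rewrite //= mulr0 add0r.
  split; first by rewrite /derivable E.
  by rewrite /derive E.
- have E : (fun h : R => h^-1 *: (((fun t => f (pt a t)) \o shift b) (h *: 1) -
      f (pt a b))) =
     (fun h : R => h^-1 *: ((f \o shift (pt a b)) (h *: e 1) - f (pt a b))).
    apply/funext => h /=; congr (_ *: (f _ - _)); apply/rowP => i; rewrite !mxE.
    by case: (ord2P i) => ->; rewrite //= mulr0 add0r.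
  split; first by rewrite /derivable E.
  by rewrite /derive E.
Qed.

(** Schwarz's theorem: two mean values, taken in either order, turn the second difference of f over
    a small square of side h into h^2 times each mixed derivative at some point of the square.
    Continuity at p then makes their values at p differ by less than any eps. *)
Lemma partial_comm (f : V -> R) (D : set V) (p : V) : open D -> D p ->
  (forall q i, D q -> derivable f q (e i)) ->
  (forall q i j, D q -> derivable (partial j (f : V -> R^o)) q (e i)) ->
  (forall i j, {for p, continuous (partial i (partial j (f : V -> R^o)))}) ->
  partial 0 (partial 1 (f : V -> R^o)) p = partial 1 (partial 0 (f : V -> R^o)) p.
Proof.
move=> oD Dp fd f2 fc; set A := partial 0 _; set B := partial 1 _.
pose a := p 0 0; pose b := p 0 1.
have pE : p = pt a b by exact: pt_eta.
apply/eqP; rewrite -subr_eq0 -normr_le0; apply/ler_addgt0Pl => eps eps0.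
rewrite addr0.
have e2 : 0 < eps / 2 by rewrite divr_gt0.
have HA : \forall q \near p, `|A p - A q| < eps / 2.
  by have /cvgrPdist_lt/(_ _ e2) := fc 0 1.
have HB : \forall q \near p, `|B p - B q| < eps / 2.
  by have /cvgrPdist_lt/(_ _ e2) := fc 1 0.
have /nbhs_ballP[r /= r0 br] : \forall q \near p,
    [/\ D q, `|A p - A q| < eps / 2 & `|B p - B q| < eps / 2].
  have HD : nbhs p D by exact: open_nbhs_nbhs.
  by apply: filterS (filterI HD (filterI HA HB)) => q [? []].
pose h := r / 2; have h0 : 0 < h by rewrite divr_gt0.
have hr : h < r by rewrite /h; lra.
have ah : a + h - a = h by ring.
have bh : b + h - b = h by ring.
have inr x y : `|x - a| <= h -> `|y - b| <= h ->
    [/\ D (pt x y), `|A p - A (pt x y)| < eps / 2 & `|B p - B (pt x y)| < eps / 2].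
  move=> hx hy; apply: br; rewrite pE; apply/ball_pt; split.
    by rewrite distrC (le_lt_trans hx).
  by rewrite distrC (le_lt_trans hy).
have hh : `|h| = h by rewrite gtr0_norm.
have l0 : `|b - b| <= h by rewrite subrr normr0 ltW.
have l1 : `|b + h - b| <= h by rewrite bh hh.
have k0 : `|a - a| <= h by rewrite subrr normr0 ltW.
have k1 : `|a + h - a| <= h by rewrite ah hh.
have [q [Dq qA] Aq] : exists2 q, D q /\ `|A p - A q| < eps / 2 &
    f (pt (a + h) (b + h)) - f (pt (a + h) b) - (f (pt a (b + h)) - f (pt a b)) =
    h * h * A q.
  have [|y] := @mean_value R (fun y => f (pt (a + h) y) - f (pt a y))
    (fun y => partial 1 (f : V -> R^o) (pt (a + h) y) - partial 1 (f : V -> R^o) (pt a y)) b (b + h).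
    rewrite bh hh => y yb.
    have [D1 _ _] := inr _ _ k1 yb; have [D2 _ _] := inr _ _ k0 yb.
    by apply: is_deriveB; apply: (is_derive_pt _ _ _).2; exact: fd.
  rewrite bh hh => yb.
  have [|x] := @mean_value R (fun x => partial 1 (f : V -> R^o) (pt x y))
    (fun x => A (pt x y)) a (a + h).
    rewrite ah hh => x xa; have [D1 _ _] := inr _ _ xa yb.
    by apply: (is_derive_pt _ _ _).1; exact: f2.
  rewrite ah hh => xa -> E; have [D1 A1 _] := inr _ _ xa yb.
  exists (pt x y); first by split.
  by rewrite -mulrA -E subrACA.
have [q' [Dq' qB] Bq] : exists2 q, D q /\ `|B p - B q| < eps / 2 &
    f (pt (a + h) (b + h)) - f (pt (a + h) b) - (f (pt a (b + h)) - f (pt a b)) =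
    h * h * B q.
  have [|x] := @mean_value R (fun x => f (pt x (b + h)) - f (pt x b))
    (fun x => partial 0 (f : V -> R^o) (pt x (b + h)) - partial 0 (f : V -> R^o) (pt x b)) a (a + h).
    rewrite ah hh => x xa.
    have [D1 _ _] := inr _ _ xa l1; have [D2 _ _] := inr _ _ xa l0.
    by apply: is_deriveB; apply: (is_derive_pt _ _ _).1; exact: fd.
  rewrite ah hh => xa.
  have [|y] := @mean_value R (fun y => partial 0 (f : V -> R^o) (pt x y))
    (fun y => B (pt x y)) b (b + h).
    rewrite bh hh => y yb; have [D1 _ _] := inr _ _ xa yb.
    by apply: (is_derive_pt _ _ _).2; exact: f2.
  rewrite bh hh => yb -> E; have [D1 _ B1] := inr _ _ xa yb.
  exists (pt x y); first by split.
  by rewrite -mulrA -E.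
move: (f (pt (a + h) (b + h)) - _ - _) Aq Bq => w.
have hh0 : h * h != 0 by rewrite mulf_neq0// gt_eqF.
move: (A p) (B p) (A q) (B q') qA qB => Ap Bp Aq Bq qA qB -> /(mulfI hh0) AB.
rewrite (_ : Ap - Bp = (Ap - Aq) - (Bp - Bq)); last by rewrite AB; ring.
rewrite (le_trans (ler_normB _ _))//; lra.
Qed.

(** The chain rule from partial derivatives alone, continuous at the point considered: the increment
    of f is split into a horizontal and a vertical one, each a mean value times an increment of x or
    y. *)
Lemma is_derive_curve (f : V -> R) (D : set V) (x y : R -> R) (dx dy t0 : R) :
  open D -> D (pt (x t0) (y t0)) ->
  (forall q i, D q -> derivable f q (e i)) ->
  (forall i, {for pt (x t0) (y t0), continuous (partial i (f : V -> R^o))}) ->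
  is_derive t0 1 x dx -> is_derive t0 1 y dy ->
  is_derive t0 1 (fun t => f (pt (x t) (y t)))
    (dx * partial 0 (f : V -> R^o) (pt (x t0) (y t0)) +
     dy * partial 1 (f : V -> R^o) (pt (x t0) (y t0))).
Proof.
move=> oD Dp fd fc xd yd; set p := pt _ _.
have [X [XE Xc X0]] := (is_derive1_caratheodory _ _ _).1 xd.
have [Y [YE Yc Y0]] := (is_derive1_caratheodory _ _ _).1 yd.
have xc := is_derive1_continuous xd; have yc := is_derive1_continuous yd.
have xn e : 0 < e -> \forall t \near t0, `|x t - x t0| < e.
  by move=> e0; have /cvgrPdist_lt/(_ _ e0) := xc; apply: filterS => t; rewrite distrC.
have yn e : 0 < e -> \forall t \near t0, `|y t - y t0| < e.
  by move=> e0; have /cvgrPdist_lt/(_ _ e0) := yc; apply: filterS => t; rewrite distrC.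
have /nbhs_ballP[r /= r0 br] : nbhs p D by exact: open_nbhs_nbhs.
pose close t := `|x t - x t0| < r /\ `|y t - y t0| < r.
have nclose : \forall t \near t0, close t.
  exact: filterI (xn _ r0) (yn _ r0).
have inD s u : `|s - x t0| < r -> `|u - y t0| < r -> D (pt s u).
  by move=> sx uy; apply: br; apply/ball_pt; rewrite distrC [`|y t0 - _|]distrC.
(* One choice for all t of both intermediate points; (0, 0) is a dummy value for t far from t0. *)
have /choice[c cP] t : exists c : R * R, close t ->
   [/\ `|c.1 - x t0| <= `|x t - x t0|, `|c.2 - y t0| <= `|y t - y t0| &
     f (pt (x t) (y t)) - f p =
     (x t - x t0) * partial 0 (f : V -> R^o) (pt c.1 (y t)) +
     (y t - y t0) * partial 1 (f : V -> R^o) (pt (x t0) c.2)].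
  have [[xt yt]|] := pselect (close t); last by move=> ?; exists (0, 0).
  have [|s] := @mean_value R (fun s => f (pt s (y t)))
    (fun s => partial 0 (f : V -> R^o) (pt s (y t))) (x t0) (x t).
    move=> s sx; apply: (is_derive_pt _ _ _).1; apply: fd; apply: inD => //.
    exact: le_lt_trans xt.
  move=> sx sE.
  have [|u] := @mean_value R (fun u => f (pt (x t0) u))
    (fun u => partial 1 (f : V -> R^o) (pt (x t0) u)) (y t0) (y t).
    move=> u uy; apply: (is_derive_pt _ _ _).2; apply: fd; apply: inD => //.
      by rewrite subrr normr0.
    exact: le_lt_trans yt.
  move=> uy uE; exists (s, u) => _; split => //=.
  rewrite -sE -uE; rewrite /p; ring.
have pc (s u : R -> R) : (\forall t \near t0, `|s t - x t0| <= `|x t - x t0|) ->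
    (\forall t \near t0, `|u t - y t0| <= `|y t - y t0|) ->
    forall i, partial i (f : V -> R^o) (pt (s t) (u t)) @[t --> t0] -->
      partial i (f : V -> R^o) p.
  move=> sx uy i.
  have : pt (s t) (u t) @[t --> t0] --> p.
    apply/cvg_ballP => eps eps0.
    apply: filterS (filterI (filterI sx uy) (filterI (xn _ eps0) (yn _ eps0))).
    move=> t [[sxt uyt] [xt yt]]; apply/ball_pt; rewrite distrC [`|_ - u t|]distrC.
    by split; [exact: le_lt_trans xt|exact: le_lt_trans yt].
  by move/cvg_comp; apply; exact: fc.
have c1 : \forall t \near t0, `|(c t).1 - x t0| <= `|x t - x t0|.
  by apply: filterS nclose => t /cP[].
have c2 : \forall t \near t0, `|(c t).2 - y t0| <= `|y t - y t0|.
  by apply: filterS nclose => t /cP[].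
have nx : \forall t \near t0, `|x t0 - x t0| <= `|x t - x t0|.
  by near=> t; rewrite subrr normr0.
have ny : \forall t \near t0, `|y t - y t0| <= `|y t - y t0|.
  by near=> t; rewrite lexx.
pose G t := X t * partial 0 (f : V -> R^o) (pt (c t).1 (y t)) +
            Y t * partial 1 (f : V -> R^o) (pt (x t0) (c t).2).
have Gc : G t @[t --> t0] --> dx * partial 0 (f : V -> R^o) p +
    dy * partial 1 (f : V -> R^o) p.
  apply: cvgD; (apply: cvgM; first by rewrite -?X0 -?Y0).
    exact: (pc _ _ c1 ny).
  exact: (pc _ _ nx c2).
apply/is_derive1_caratheodory.
exists (fun t => if t == t0 then dx * partial 0 (f : V -> R^o) p +
    dy * partial 1 (f : V -> R^o) p
  else (f (pt (x t) (y t)) - f p) / (t - t0)); split.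
- move=> z; case: eqVneq => [->|zt]; first by rewrite !subrr mulr0.
  by rewrite divfK// subr_eq0.
- apply/continuous_withinNx; rewrite eqxx.
  have : G t @[t --> t0^'] --> dx * partial 0 (f : V -> R^o) p +
    dy * partial 1 (f : V -> R^o) p.
    by apply: cvg_within_filter; exact: Gc.
  apply: cvg_trans; apply: near_eq_cvg; near=> t.
  have tt0 : t != t0 by near: t; exact: nbhs_dnbhs_neq.
  have ct : close t by near: t; exact: nbhs_dnbhs.
  rewrite (negbTE tt0); have [_ _ ->] := cP _ ct.
  by rewrite XE YE /G; field; rewrite subr_eq0.
- by rewrite eqxx.
Unshelve. all: by end_near. Qed.

End PlaneCalculus.

(** * Smooth maps and vectors of space *)

Section SmoothCoordinates.
Context {R : realType} {n : nat}.
Local Notation V := 'rV[R]_n.+1.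

(** Differentiating once more requires the induction hypothesis near p and not only at p, which
    openness of D provides. *)
Lemma iter_partial_coord m (D : set V) (f : V -> 'rV[R]_m.+1) (k : 'I_m.+1) :
  open D -> smooth_on D f -> forall s p, D p ->
  iter_partial s (fun q => f q 0 k : R^o) p = iter_partial s f p 0 k.
Proof.
move=> oD fD; elim=> [//|i s ih] p Dp /=.
have fg : \forall q \near p, iter_partial s (fun q => f q 0 k : R^o) q =
    iter_partial s f q 0 k.
  by apply: filterS (open_nbhs_nbhs (conj oD Dp)) => q; exact: ih.
rewrite /partial (near_eq_derive _ fg).
have /(_ i) fd := (fD s p Dp).2.
by rewrite (derive_mx fd) mxE.
Qed.

Lemma smooth_on_coord m (D : set V) (f : V -> 'rV[R]_m.+1) (k : 'I_m.+1) :
  open D -> smooth_on D f -> smooth_on D (fun q => f q 0 k : R^o).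
Proof.
move=> oD fD s p Dp.
have fg : \forall q \near p, iter_partial s f q 0 k =
    iter_partial s (fun q => f q 0 k : R^o) q.
  apply: filterS (open_nbhs_nbhs (conj oD Dp)) => q Dq.
  by rewrite (iter_partial_coord _ oD fD).
split=> [|i].
- rewrite /prop_for /continuous_at (iter_partial_coord _ oD fD)//.
  apply: (cvg_trans (near_eq_cvg fg)).
  have fc := (fD s p Dp).1.
  exact: (continuous_comp fc (@coord_continuous R _ _ 0 k _)).
- apply: (near_eq_derivable fg).
  have /(_ i) fd := (fD s p Dp).2.
  by have /derivable_mxP/(_ 0 k) := fd.
Qed.

Lemma iter_partialB (D : set V) (f g : V -> R^o) :
  open D -> smooth_on D f -> smooth_on D g -> forall s p, D p ->
  iter_partial s (fun q => f q - g q : R^o) p = iter_partial s f p - iter_partial s g p.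
Proof.
move=> oD fD gD; elim=> [//|i s ih] p Dp /=.
have fg : \forall q \near p, iter_partial s (fun q => f q - g q : R^o) q =
    iter_partial s f q - iter_partial s g q.
  by apply: filterS (open_nbhs_nbhs (conj oD Dp)) => q; exact: ih.
rewrite /partial (near_eq_derive _ fg) deriveB//; first exact: (fD s p Dp).2.
exact: (gD s p Dp).2.
Qed.

Lemma smooth_onB (D : set V) (f g : V -> R^o) :
  open D -> smooth_on D f -> smooth_on D g ->
  smooth_on D (fun q => f q - g q : R^o).
Proof.
move=> oD fD gD s p Dp.
have fg : \forall q \near p, iter_partial s f q - iter_partial s g q =
    iter_partial s (fun q => f q - g q : R^o) q.
  by apply: filterS (open_nbhs_nbhs (conj oD Dp)) => q Dq; rewrite (iter_partialB oD).
split=> [|i].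
- rewrite /prop_for /continuous_at (iter_partialB oD fD gD)//.
  apply: (cvg_trans (near_eq_cvg fg)).
  by apply: cvgB; [exact: (fD s p Dp).1|exact: (gD s p Dp).1].
- apply: (near_eq_derivable fg).
  by apply: derivableB; [exact: (fD s p Dp).2|exact: (gD s p Dp).2].
Qed.

End SmoothCoordinates.

Section SmoothPlane.
Context {R : realType}.
Local Notation V := 'rV[R]_2.

Lemma smooth_partial_comm (D : set V) (f : V -> R^o) p : open D -> D p ->
  smooth_on D f -> partial 0 (partial 1 f) p = partial 1 (partial 0 f) p.
Proof.
move=> oD Dp fD; apply: (partial_comm oD Dp).
- by move=> q i Dq; exact: (fD [::] q Dq).2.
- by move=> q i j Dq; exact: (fD [:: j] q Dq).2.
- by move=> i j; exact: (fD [:: i; j] p Dp).1.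
Qed.

Lemma smooth_partial_commv m (D : set V) (f : V -> 'rV[R]_m.+1) p :
  open D -> D p -> smooth_on D f ->
  partial 0 (partial 1 f) p = partial 1 (partial 0 f) p.
Proof.
move=> oD Dp fD; apply/rowP => k.
have E01 := iter_partial_coord k oD fD [:: 0; 1] Dp.
have E10 := iter_partial_coord k oD fD [:: 1; 0] Dp.
have E := smooth_partial_comm oD Dp (smooth_on_coord k oD fD).
exact: etrans (esym E01) (etrans E E10).
Qed.
End SmoothPlane.

Section Vectors3.
Context {R : realType}.
Implicit Types x y : 'rV[R]_3.

Lemma dotE x y :
  dot x y = x 0 0 * y 0 0 + x 0 1 * y 0 1 + x 0 2%:R * y 0 2%:R.
Proof.
rewrite /dot !big_ord_recl big_ord0 addr0 addrA.
by congr (_ + _ * _ + _ * _); congr (_ _ _); exact: val_inj.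
Qed.

Lemma ord3P (i : 'I_3) : [\/ i = 0, i = 1 | i = 2%:R].
Proof.
by case: i => [[|[|[|]]]]// ?; [apply: Or31|apply: Or32|apply: Or33]; exact: val_inj.
Qed.

Lemma crossE x y :
  [/\ cross x y 0 0 = x 0 1 * y 0 2%:R - x 0 2%:R * y 0 1,
      cross x y 0 1 = x 0 2%:R * y 0 0 - x 0 0 * y 0 2%:R &
      cross x y 0 2%:R = x 0 0 * y 0 1 - x 0 1 * y 0 0].
Proof.
by split; rewrite mxE; congr (_ * _ - _ * _); congr (_ _ _); exact: val_inj.
Qed.

Lemma dotC x y : dot x y = dot y x.
Proof. by apply: eq_bigr => i _; rewrite mulrC. Qed.

Lemma dotDl x y z : dot (x + y) z = dot x z + dot y z.
Proof. by rewrite -big_split; apply: eq_bigr => i _; rewrite mxE mulrDl. Qed.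

Lemma dotZr c x y : dot x (c *: y) = c * dot x y.
Proof. by rewrite mulr_sumr; apply: eq_bigr => i _; rewrite mxE; ring. Qed.

Lemma dotZl c x y : dot (c *: x) y = c * dot x y.
Proof. by rewrite dotC dotZr dotC. Qed.

(** Lagrange's identity. *)
Lemma dot_cross x y :
  dot (cross x y) (cross x y) = dot x x * dot y y - dot x y ^+ 2.
Proof. by rewrite !dotE; have [-> -> ->] := crossE x y; ring. Qed.

(** With N = x × y, the vector z × N = <z, y> x - <z, x> y is 0 (its coordinates are [tri]), and N ×
    (z × N) = |N|^2 z - <z, N> N. *)
Lemma normal_component x y z : dot z x = 0 -> dot z y = 0 ->
  dot (cross x y) (cross x y) *: z = dot z (cross x y) *: cross x y.
Proof.
move=> zx zy; have [C0 C1 C2] := crossE x y.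
have tri i : x 0 i * dot z y - y 0 i * dot z x = 0 by rewrite zx zy !mulr0 subrr.
have := tri 0; have := tri 1; have := tri 2%:R; rewrite !dotE.
move: (cross x y) C0 C1 C2 => N C0 C1 C2 T2 T1 T0.
apply/rowP => i; rewrite !mxE; apply/eqP; rewrite -subr_eq0; apply/eqP.
case: (ord3P i) => ->; rewrite C0 C1 C2.
(* The two zeros stand for coordinates of z × N, so that this is a coordinate of N × (z × N);
   likewise in the next two cases. *)
- transitivity ((x 0 2%:R * y 0 0 - x 0 0 * y 0 2%:R) * 0 - (x 0 0 * y 0 1 - x 0 1 * y 0 0) * (0:R)); last by ring.
  by rewrite -{1}T2 -T1; ring.
- transitivity ((x 0 0 * y 0 1 - x 0 1 * y 0 0) * 0 - (x 0 1 * y 0 2%:R - x 0 2%:R * y 0 1) * (0:R)); last by ring.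
  by rewrite -{1}T0 -T2; ring.
- transitivity ((x 0 1 * y 0 2%:R - x 0 2%:R * y 0 1) * 0 - (x 0 2%:R * y 0 0 - x 0 0 * y 0 2%:R) * (0:R)); last by ring.
  by rewrite -{1}T1 -T0; ring.
Qed.

Lemma derive_dot (W : normedModType R) (F G : W -> 'rV[R]_3) (p v : W) :
  derivable F p v -> derivable G p v ->
  'D_v (fun q => dot (F q) (G q)) p = dot ('D_v F p) (G p) + dot (F p) ('D_v G p).
Proof.
move=> Fd Gd.
have Fi i : is_derive p v (fun q => F q 0 i) (('D_v F p) 0 i).
  by rewrite (derive_mx Fd) mxE; apply: derivableP; move/derivable_mxP: Fd; exact.
have Gi i : is_derive p v (fun q => G q 0 i) (('D_v G p) 0 i).
  by rewrite (derive_mx Gd) mxE; apply: derivableP; move/derivable_mxP: Gd; exact.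
have := is_derive_sum (fun i : 'I_3 => is_deriveM (Fi i) (Gi i)).
rewrite fct_sumE => -[_].
rewrite [LHS](_ : _ = 'D_v (fun q => dot (F q) (G q)) p); last by [].
by move=> ->; rewrite -big_split; apply: eq_bigr => i _; rewrite /GRing.scale/=; ring.
Qed.
End Vectors3.

(** * The mean curvature equation *)

Section MeanCurvature.
Context {R : realType}.
Local Notation V := 'rV[R]_2.
Local Notation e i := (delta_mx 0 i : V).

Lemma char_poly2_trace (A : 'M[R]_2) (k1 k2 : R) :
  char_poly A = ('X - k1%:P) * ('X - k2%:P) -> \tr A = k1 + k2.
Proof.
move=> cpA; have := @char_poly_trace R 2 A isT.
rewrite cpA /= mulrBl !mulrBr -polyCM !(coefB, coefXM, coefCM, coefX, coefC)/=.
move=> trA; rewrite -[LHS]opprK -trA; ring.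
Qed.

Lemma derive_eq_on (D : set V) (f g : V -> R) p v : open D -> D p ->
  (forall q, D q -> f q = g q) -> 'D_v (f : V -> R^o) p = 'D_v (g : V -> R^o) p.
Proof.
move=> oD Dp fg; apply: near_eq_derive.
by apply: filterS (open_nbhs_nbhs (conj oD Dp)) => q; exact: fg.
Qed.

Lemma dot_cross_conformal (x y : 'rV[R]_3) (l : R) :
  dot x y = 0 -> dot x x = l ^+ 2 -> dot y y = l ^+ 2 ->
  dot (cross x y) (cross x y) = l ^+ 4.
Proof. by move=> xy xx yy; rewrite dot_cross xy xx yy; ring. Qed.

(** Read u, v as the first derivatives of phi, a and b as phi_uu and phi_vv, and m, m' as the mixed
    derivatives. The hypotheses are the derivatives of <u, v> = 0 and of <u, u> = <v, v>. *)
Lemma dot_sum_frame (a b m m' u v : 'rV[R]_3) : m' = m ->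
  dot a v + dot u m' = 0 -> dot m v + dot u b = 0 ->
  dot a u = dot m' v -> dot m u = dot b v ->
  dot (a + b) u = 0 /\ dot (a + b) v = 0.
Proof.
move=> -> h1 h2 h3 h4; rewrite !dotDl.
move: h1 h2 h3 h4; rewrite ![dot u _]dotC; lra.
Qed.

(** The conformality relations are differentiated on the open set D. Of the last two, it is their
    common consequence |phi_u|^2 = |phi_v|^2 that is differentiated, never lambda. *)
Lemma conformal_laplacian_tangent (D : set V) (phi : V -> 'rV[R]_3)
    (lambda : V -> R) p : open D -> D p -> smooth_on D phi ->
  (forall p, D p ->
        [/\ dot (partial 0 phi p) (partial 1 phi p) = 0,
            dot (partial 0 phi p) (partial 0 phi p) = lambda p ^+ 2 &
            dot (partial 1 phi p) (partial 1 phi p) = lambda p ^+ 2]) ->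
  let L := partial 0 (partial 0 phi) p + partial 1 (partial 1 phi) p in
  dot L (partial 0 phi p) = 0 /\ dot L (partial 1 phi p) = 0.
Proof.
move=> oD Dp sphi conf L.
have comm := smooth_partial_commv oD Dp sphi.
have ud i : derivable (partial 0 phi) p (e i) by exact: (sphi [:: 0] p Dp).2.
have vd i : derivable (partial 1 phi) p (e i) by exact: (sphi [:: 1] p Dp).2.
have uv i : dot (partial i (partial 0 phi) p) (partial 1 phi p) +
    dot (partial 0 phi p) (partial i (partial 1 phi) p) = 0.
  apply: etrans (esym (derive_dot (ud i) (vd i))) _.
  apply: etrans (derive_cst (0 : R^o) p (e i)).
  apply: (@derive_eq_on D _ (cst 0) _ _ oD Dp) => q Dq.
  by have [h _ _] := conf q Dq; exact: h.
have half (a b c d : 'rV[R]_3) :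
    dot a b + dot b a = dot c d + dot d c -> dot a b = dot c d.
  by rewrite [dot b a]dotC [dot d c]dotC => h; lra.
have uuvv i : dot (partial i (partial 0 phi) p) (partial 0 phi p) =
    dot (partial i (partial 1 phi) p) (partial 1 phi p).
  apply: half; apply: etrans (esym (derive_dot (ud i) (ud i))) _.
  apply: etrans (derive_dot (vd i) (vd i)).
  apply: (derive_eq_on _ oD Dp) => q Dq.
  by have [_ huu hvv] := conf q Dq; exact: etrans huu (esym hvv).
exact: (dot_sum_frame comm (uv 0) (uv 1) (uuvv 0) (uuvv 1)).
Qed.

(** The Laplacian is normal to the surface, so one product with the normal determines it. The first
    form is lambda^2 times the identity, hence the trace k1 + k2 of the shape operator is that
    product divided by lambda^2; and |phi_u × phi_v| = lambda^2. *)
Lemma mean_curvature_equation (D : set V) (S : set 'rV[R]_3)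
    (phi : V -> 'rV[R]_3) (lambda H : V -> R) p : open D -> D p ->
  conformal_parameterization D S phi lambda -> mean_curvature_on D phi H ->
  partial 0 (partial 0 phi) p + partial 1 (partial 1 phi) p =
  (2 * H p) *: cross (partial 0 phi p) (partial 1 phi p).
Proof.
move=> oD Dp [[sphi _ _] _ lam0 conf] curv.
have [] := conformal_laplacian_tangent oD Dp sphi conf.
have [k1 [k2 [/char_poly2_trace trE HE]]] := curv p Dp.
have l0 := lam0 p Dp.
have [uv uu vv] := conf p Dp.
have ffE : first_form phi p = (lambda p ^+ 2)%:M.
  apply/matrixP => i j; rewrite !mxE.
  case: (ord2P i) => ->; case: (ord2P j) => ->.
  - exact: uu.
  - exact: uv.
  - exact: etrans (dotC _ _) uv.
  - exact: vv.
have NN : dot (cross (partial 0 phi p) (partial 1 phi p))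
    (cross (partial 0 phi p) (partial 1 phi p)) = lambda p ^+ 4.
  exact: dot_cross_conformal uv uu vv.
have trS : dot (partial 0 (partial 0 phi) p) (unit_normal phi p) +
    dot (partial 1 (partial 1 phi) p) (unit_normal phi p) =
    2 * H p * lambda p ^+ 2.
  have -> : 2 * H p = k1 + k2 by rewrite HE; field.
  rewrite -trE /shape_operator ffE invmx_scalar mul_scalar_mx mxtraceZ.
  rewrite mulrAC mulVf ?mul1r ?expf_neq0 ?gt_eqF//.
  by rewrite /mxtrace !big_ord_recl big_ord0 addr0 !mxE; congr (_ + _);
    congr (dot (partial _ (partial _ _) _) _); exact: val_inj.
move: trS; rewrite -dotDl /unit_normal /enorm NN dotZr.
rewrite (_ : lambda p ^+ 4 = (lambda p ^+ 2) ^+ 2) in NN *; last by rewrite -exprM.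
rewrite sqrtr_sqr ger0_norm ?sqr_ge0//.
move: (_ + _) NN => L NN trS Lu Lv.
have := normal_component Lu Lv; rewrite NN.
have -> : dot L (cross (partial 0 phi p) (partial 1 phi p)) =
    (2 * H p) * (lambda p ^+ 2) ^+ 2.
  rewrite expr2 mulrA -trS; field; exact: lt0r_neq0.
have l4 : (lambda p ^+ 2) ^+ 2 != 0 by rewrite !expf_neq0// gt_eqF.
by rewrite [2 * _ * _]mulrC -(scalerA _ (2 * H p)) => h; apply: (scalerI l4); exact: h.
Qed.

End MeanCurvature.

(** * Unique continuation *)

(** [acos] reaches the half circle b >= 0; its reflection 2 pi - acos covers the other half. *)
Lemma polar_coordinates (R : realType) (a b r : R) : 0 < r ->
  a ^+ 2 + b ^+ 2 = r ^+ 2 ->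
  exists y, [/\ 0 <= y <= pi *+ 2, a = r * cos y & b = r * sin y].
Proof.
move=> r0 abr; have rn0 : r != 0 by rewrite gt_eqF.
pose t := a / r.
have t2 : 1 - t ^+ 2 = (b / r) ^+ 2.
  rewrite /t !expr_div_n; apply: (@mulIf _ (r ^+ 2)); first by rewrite expf_neq0.
  by rewrite mulrBl mul1r !divfK ?expf_neq0// -abr; ring.
have t1 : -1 <= t <= 1.
  rewrite -ler_norml -(@ler_pXn2r _ 2)// ?nnegrE// expr1n real_normK ?num_real//.
  by rewrite -subr_ge0 t2 sqr_ge0.
have cosa : cos (acos t) = t by apply: acosK; rewrite in_itv.
have sina : sin (acos t) = `|b / r| by rewrite sin_acos// t2 sqrtr_sqr.
have at0 := acos_ge0 t1; have atpi := acos_lepi t1.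
have rt : a = r * t by rewrite /t mulrC divfK.
have rb : b = r * (b / r) by rewrite mulrC divfK.
have [b0|b0] := leP 0 b.
- exists (acos t); split; last 2 first.
  + by rewrite cosa.
  + by rewrite sina ger0_norm// divr_ge0// ltW.
  rewrite at0 (le_trans atpi)// mulr2n lerDl; exact: pi_ge0.
- exists (pi *+ 2 - acos t); split.
  + rewrite subr_ge0 lerBlDr lerDl at0 andbT (le_trans atpi)// mulr2n lerDl.
    exact: pi_ge0.
  + by rewrite cosB cos2pi sin2pi mul1r mul0r addr0 cosa.
  + rewrite sinB cos2pi sin2pi mul1r mul0r sub0r sina ltr0_norm ?opprK//.
    by rewrite pmulr_llt0// invr_gt0.
Qed.

Section PlaneBoxes.
Context {R : realType}.
Local Notation V := 'rV[R]_2.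

Lemma continuous_pt (T : topologicalType) (x y : T -> R) (t : T) :
  {for t, continuous x} -> {for t, continuous y} ->
  {for t, continuous (fun t => pt (x t) (y t))}.
Proof.
move=> xc yc; apply/cvg_ballP => eps eps0.
have xn : \forall u \near t, `|x t - x u| < eps by have /cvgrPdist_lt/(_ _ eps0) := xc.
have yn : \forall u \near t, `|y t - y u| < eps by have /cvgrPdist_lt/(_ _ eps0) := yc.
by apply: filterS (filterI xn yn) => u [? ?]; exact/ball_pt.
Qed.

(** The closed ball of the sup norm, which is the norm of row vectors, written by coordinates so
    that it is compact as a product of segments. *)
Definition closed_box (c : V) (r : R) : set V :=
  [set q | forall i, `|q 0 i - c 0 i| <= r].

Lemma closed_box_ball (c : V) (r rho : R) : r < rho -> 0 < rho ->
  closed_box c r `<=` ball c rho.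
Proof.
move=> rrho rho0 q qc; split=> // i j; rewrite ord1 /ball/= distrC.
exact: le_lt_trans rrho.
Qed.

Lemma compact_closed_box (c : V) (r : R) : compact (closed_box c r).
Proof.
have := @rV_compact R 2 (fun i => `[c 0 i - r, c 0 i + r]%classic)
  (fun i => @segment_compact _ _ _).
congr compact; apply/seteqP; split => q /= h i; have := h i; rewrite /= in_itv/=.
- by rewrite ler_distl.
- by rewrite ler_distl => ->.
Qed.

Lemma bounded_on_box (n : nat) (h : 'I_n -> V -> R) (D : set V) (c : V) (r : R) :
  (forall i q, D q -> {for q, continuous (h i)}) -> closed_box c r `<=` D ->
  exists M, forall i q, closed_box c r q -> `|h i q| <= M.
Proof.
move=> hc KD.
have /choice[M Mh] i : exists M, forall q, closed_box c r q -> `|h i q| <= M.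
  have [K0|/set0P/negP/negPn/eqP K0] := pselect (closed_box c r !=set0).
    have [|q Kq qmax] := @EVT_max_rV R 2 (fun q => `|h i q|) _ K0 (@compact_closed_box c r).
      apply: continuous_in_subspaceT => q; rewrite inE => /KD/hc hq.
      exact: (continuous_comp (hq i) (@norm_continuous _ _ _)).
    by exists `|h i q| => q' Kq'; apply: qmax; rewrite inE.
  (* The box is empty when r < 0. *)
  by exists 0 => q; rewrite K0.
exists (\sum_i `|M i|) => i q Kq; rewrite (le_trans (Mh i q Kq))//.
rewrite (le_trans (ler_norm _))// (bigD1 i)//= lerDl.
by apply: sumr_ge0 => j _.
Qed.

End PlaneBoxes.

Lemma smooth_on_partial (R : realType) n (W : normedModType R)
    (D : set 'rV[R]_n.+1) (f : 'rV[R]_n.+1 -> W) (i : 'I_n.+1) :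
  smooth_on D f -> smooth_on D (partial i f).
Proof.
move=> fD s p Dp; have := fD (rcons s i) p Dp.
by rewrite /iter_partial foldr_rcons.
Qed.

(** * The gradient system in polar coordinates *)

Definition join_family (T : Type) n (u v : 'I_n -> T) (i : 'I_(n + n)) : T :=
  match fintype.split i with inl k => u k | inr k => v k end.

Lemma join_familyl (T : Type) n (u v : 'I_n -> T) k :
  join_family u v (lshift n k) = u k.
Proof. by rewrite /join_family (unsplitK (inl k)). Qed.

Lemma join_familyr (T : Type) n (u v : 'I_n -> T) k :
  join_family u v (rshift n k) = v k.
Proof. by rewrite /join_family (unsplitK (inr k)). Qed.

Lemma join_family_ind (T : Type) (P : T -> Prop) n (u v : 'I_n -> T) :
  (forall k, P (u k)) -> (forall k, P (v k)) -> forall i, P (join_family u v i).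
Proof. by move=> Pu Pv i; rewrite /join_family; case: fintype.split. Qed.

(** Here t = exp(x), c = cos y, s = sin y, and the two squares are those of the components of f_x -
    S f. Once the curl vanishes these components are t c div and t s div, where div = au + bv. *)
Lemma polar_divergence_curl (R : comPzRingType) (t c s au av bu bv : R) :
  c ^+ 2 + s ^+ 2 = 1 -> av = bu ->
  (t * c * au + t * s * av - - (- (t * s) * bu + t * c * bv)) ^+ 2 +
  (t * c * bu + t * s * bv - (- (t * s) * au + t * c * av)) ^+ 2 =
  t ^+ 2 * (au + bv) ^+ 2.
Proof.
move=> cs ->.
transitivity (t ^+ 2 * (c ^+ 2 + s ^+ 2) * (au + bv) ^+ 2); first by ring.
by rewrite cs mulr1.
Qed.

Lemma leibniz_cross (R : comPzRingType) (p q u v p' q' u' v' : R) :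
  p * v' + v * p' - (q * u' + u * q') = p' * v + p * v' - (q' * u + q * u').
Proof. ring. Qed.

Lemma rotate_cross (R : comPzRingType) (p q u v p' q' u' v' : R) :
  p' * v + p * v' - (q' * u + q * u') = - q' * u + p' * v - (p * - v' + q * u').
Proof. ring. Qed.

Section PolarContinuation.
Context {R : realType}.
Local Notation V := 'rV[R]_2.
Variables (n : nat) (a b : 'I_n -> V -> R^o) (D : set V) (c : V) (rho : R).
Hypotheses (oD : open D) (cD : ball c rho `<=` D) (rho0 : 0 < rho).
Hypotheses (sa : forall k, smooth_on D (a k)) (sb : forall k, smooth_on D (b k)).
Hypothesis curl : forall k q, D q -> partial 1 (a k) q = partial 0 (b k) q.
Variable r : R.
Hypotheses (r0 : 0 < r) (rrho : r < rho).
Variable C : R.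
Hypothesis C0 : 0 <= C.
Hypothesis div_le : forall k q, closed_box c r q ->
  (partial 0 (a k) q + partial 1 (b k) q) ^+ 2 <=
  C * \sum_j (a j q ^+ 2 + b j q ^+ 2).

(* In the notation of the header comment, f and s below are f and S f. *)
Let G := join_family a b.
Let P x y := pt (c 0 0 + expR x * cos y) (c 0 1 + expR x * sin y).
Let f i x y : R := G i (P x y).
Let df i x y : R := expR x * cos y * partial 0 (G i) (P x y) +
  expR x * sin y * partial 1 (G i) (P x y).
Let fy i x y : R := - (expR x * sin y) * partial 0 (G i) (P x y) +
  expR x * cos y * partial 1 (G i) (P x y).
Let s := join_family (fun k x y => - fy (rshift n k) x y)
  (fun k x y => fy (lshift n k) x y).

Let sG i : smooth_on D (G i).
Proof. by apply: join_family_ind. Qed.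

Let expr_le x : x < ln r -> expR x <= r.
Proof. by move=> xr; rewrite -[leRHS]lnK ?posrE// ler_expR ltW. Qed.

Let P_box x y : x < ln r -> closed_box c r (P x y).
Proof.
move=> /expr_le xr i; rewrite mxE.
have h (t : R) : `|t| <= 1 -> `|expR x * t| <= r.
  move=> t1; rewrite normrM ger0_norm ?expR_ge0//.
  by rewrite (le_trans _ xr)// ler_piMr// expR_ge0.
case: (ord2P i) => -> /=; rewrite addrC addKr.
  exact/h/cos_max.
exact/h/sin_max.
Qed.

Let box_D : closed_box c r `<=` D.
Proof. by apply: subset_trans cD; exact: closed_box_ball. Qed.

Let P_D x y : x < ln r -> D (P x y).
Proof. by move=> xr; apply: box_D; exact: P_box. Qed.

Let continuous_polar_x (h : V -> R) : (forall q, D q -> {for q, continuous h}) ->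
  forall x y, x < ln r -> {for x, continuous (fun x => h (P x y))}.
Proof.
move=> hc x y xr.
have Pc : {for x, continuous (fun x => P x y)}.
  by apply: continuous_pt; apply: cvgD;
    [exact: cvg_cst|apply: cvgM; [exact: continuous_expR|exact: cvg_cst]
    |exact: cvg_cst|apply: cvgM; [exact: continuous_expR|exact: cvg_cst]].
exact: (continuous_comp Pc (hc _ (P_D y xr))).
Qed.

Let continuous_polar_y (h : V -> R) : (forall q, D q -> {for q, continuous h}) ->
  forall x, x < ln r -> continuous (fun y => h (P x y)).
Proof.
move=> hc x xr y.
have Pc : {for y, continuous (P x)}.
  apply: continuous_pt; (apply: cvgD; first exact: cvg_cst);
    (apply: cvgM; first exact: cvg_cst).
    exact: continuous_cos.
  exact: continuous_sin.
exact: (continuous_comp Pc (hc _ (P_D y xr))).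
Qed.

Let Gc i q : D q -> {for q, continuous (G i : V -> R)}.
Proof. by move=> Dq; exact: (sG i [::] Dq).1. Qed.

Let Gpc i j q : D q -> {for q, continuous (partial j (G i) : V -> R)}.
Proof. by move=> Dq; exact: (sG i [:: j] Dq).1. Qed.

Let f_derive_x i (x y : R) : x < ln r -> is_derive x 1 (f i ^~ y) (df i x y).
Proof.
move=> xr.
apply: (@is_derive_curve R (G i) D (fun x => c 0 0 + expR x * cos y)
  (fun x => c 0 1 + expR x * sin y)) => //.
- exact: P_D.
- by move=> q j Dq; exact: (sG i [::] Dq).2.
- by move=> j; apply: Gpc; exact: P_D.
- by apply: is_derive_eq; rewrite /GRing.scale/=; ring.
- by apply: is_derive_eq; rewrite /GRing.scale/=; ring.
Qed.

Let f_derive_y i (x y : R) : x < ln r -> is_derive y 1 (f i x) (fy i x y).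
Proof.
move=> xr.
apply: (@is_derive_curve R (G i) D (fun y => c 0 0 + expR x * cos y)
  (fun y => c 0 1 + expR x * sin y)) => //.
- exact: P_D.
- by move=> q j Dq; exact: (sG i [::] Dq).2.
- by move=> j; apply: Gpc; exact: P_D.
- by apply: is_derive_eq; rewrite /GRing.scale/=; ring.
- by apply: is_derive_eq; rewrite /GRing.scale/=; ring.
Qed.

Let f_continuous_y i x : x < ln r -> continuous (f i x).
Proof. by move=> xr; exact: continuous_polar_y (@Gc i) _ xr. Qed.

Let df_continuous_y i x : x < ln r -> continuous (df i x).
Proof.
move=> xr y; apply: cvgD; apply: cvgM.
- by apply: cvgM; [exact: cvg_cst|exact: continuous_cos].
- exact: (continuous_polar_y (@Gpc i 0) xr).
- by apply: cvgM; [exact: cvg_cst|exact: continuous_sin].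
- exact: (continuous_polar_y (@Gpc i 1) xr).
Qed.

Let fy_continuous_y i x : x < ln r -> continuous (fy i x).
Proof.
move=> xr y; apply: cvgD; apply: cvgM.
- by apply: cvgN; apply: cvgM; [exact: cvg_cst|exact: continuous_sin].
- exact: (continuous_polar_y (@Gpc i 0) xr).
- by apply: cvgM; [exact: cvg_cst|exact: continuous_cos].
- exact: (continuous_polar_y (@Gpc i 1) xr).
Qed.

Let fy_continuous_x i x y : x < ln r -> {for x, continuous (fy i ^~ y)}.
Proof.
move=> xr; rewrite /prop_for /continuous_at; apply: cvgD; apply: cvgM.
- by apply: cvgN; apply: cvgM; [exact: continuous_expR|exact: cvg_cst].
- exact: (continuous_polar_x (@Gpc i 0) xr).
- by apply: cvgM; [exact: continuous_expR|exact: cvg_cst].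
- exact: (continuous_polar_x (@Gpc i 1) xr).
Qed.

(** The bound is uniform as x tends to minus infinity: the points stay in a compact box inside D,
    and the polar factors satisfy exp(x) <= r. *)
Let bounds : exists M, forall i x y, x < ln r ->
  [/\ `|f i x y| <= M, `|df i x y| <= M & `|fy i x y| <= M].
Proof.
have [M0 hM0] := bounded_on_box Gc box_D.
have [M1 hM1] := bounded_on_box (fun i => @Gpc i 0) box_D.
have [M2 hM2] := bounded_on_box (fun i => @Gpc i 1) box_D.
exists (`|M0| + r * `|M1| + r * `|M2|) => i x y xr.
have Pb := P_box y xr; have er := expr_le xr.
have le0 : `|f i x y| <= `|M0| by rewrite (le_trans (hM0 i _ Pb))// ler_norm.
have le1 (t : R) : `|t| <= 1 ->
    `|expR x * t * partial 0 (G i) (P x y)| <= r * `|M1|.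
  move=> t1; rewrite normrM ler_pM//; last by rewrite (le_trans (hM1 i _ Pb))// ler_norm.
  by rewrite normrM ger0_norm ?expR_ge0// (le_trans _ er)// ler_piMr// expR_ge0.
have le2 (t : R) : `|t| <= 1 ->
    `|expR x * t * partial 1 (G i) (P x y)| <= r * `|M2|.
  move=> t1; rewrite normrM ler_pM//; last by rewrite (le_trans (hM2 i _ Pb))// ler_norm.
  by rewrite normrM ger0_norm ?expR_ge0// (le_trans _ er)// ler_piMr// expR_ge0.
have rM1 : 0 <= r * `|M1| by rewrite mulr_ge0// ltW.
have rM2 : 0 <= r * `|M2| by rewrite mulr_ge0// ltW.
have M00 := normr_ge0 M0.
split; first by rewrite (le_trans le0)// -addrA lerDl addr_ge0.
- apply: le_trans (ler_normD _ _) _.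
  apply: le_trans (lerD (le1 _ (cos_max y)) (le2 _ (sin_max y))) _.
  by rewrite -addrA lerDr.
- apply: le_trans (ler_normD _ _) _; rewrite mulNr normrN.
  apply: le_trans (lerD (le1 _ (sin_max y)) (le2 _ (cos_max y))) _.
  by rewrite -addrA lerDr.
Qed.

Let s_fy (Q : (R -> R -> R) -> Prop) : (forall i, Q (fy i)) ->
  (forall i, Q (fun x y => - fy i x y)) -> forall i, Q (s i).
Proof. by move=> Qf QNf; apply: join_family_ind => k. Qed.

(** For each k the difference of the integrands is the y-derivative of a_k(x) b_k(z) - b_k(x)
    a_k(z), a function of period 2 pi. *)
Let s_symmetric x z : x < ln r -> z < ln r ->
  angular_dot (s ^~ x) (f ^~ z) = angular_dot (f ^~ x) (s ^~ z).
Proof.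
move=> xr zr; apply/eqP; rewrite -subr_eq0; apply/eqP.
have fc i t : t < ln r -> continuous (f i t) := @f_continuous_y i t.
have sc i t : t < ln r -> continuous (s i t).
  move=> tr; apply: (s_fy (Q := fun g => continuous (g t))) => j.
    exact: fy_continuous_y.
  by move=> y; apply: cvgN; exact: fy_continuous_y.
have c1 : continuous (fun y => \sum_i s i x y * f i z y).
  apply: continuous_big => [|i _ y]; first exact: add_continuous.
  by apply: cvgM; [exact: sc|exact: fc].
have c2 : continuous (fun y => \sum_i f i x y * s i z y).
  apply: continuous_big => [|i _ y]; first exact: add_continuous.
  by apply: cvgM; [exact: fc|exact: sc].
rewrite /angular_dot -mulN1r -angular_integralZ// -angular_integralD//; last first.
  by move=> y; apply: cvgM; [exact: cvg_cst|exact: c2].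
pose l (k : 'I_n) : 'I_(n + n) := lshift n k.
pose rr (k : 'I_n) : 'I_(n + n) := rshift n k.
pose F k y := f (l k) x y * f (rr k) z y - f (rr k) x y * f (l k) z y.
pose dF k y := fy (l k) x y * f (rr k) z y + f (l k) x y * fy (rr k) z y -
  (fy (rr k) x y * f (l k) z y + f (rr k) x y * fy (l k) z y).
apply: (@angular_integral_derive R (\sum_(k < n) F k)).
- move=> y.
  have Fd k : is_derive y 1 (F k) (dF k y).
    have d1 := f_derive_y (l k) y xr; have d2 := f_derive_y (rr k) y xr.
    have d3 := f_derive_y (l k) y zr; have d4 := f_derive_y (rr k) y zr.
    apply: (is_derive_eq (is_deriveB (is_deriveM d1 d4) (is_deriveM d2 d3))).
    exact: leibniz_cross.
  have := is_derive_sum Fd; move/is_derive_eq; apply.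
  rewrite [X in _ = X + _]big_split_ord [X in _ = _ + -1 * X]big_split_ord/=.
  rewrite mulN1r -!big_split/= -sumrN -big_split/=; apply: eq_bigr => k _.
  by rewrite /s !join_familyl !join_familyr; exact: rotate_cross.
- by move=> y; apply: cvgD; [exact: c1|apply: cvgM; [exact: cvg_cst|exact: c2]].
- rewrite !fct_sumE; apply: eq_bigr => k _; rewrite /F /f /P.
  by rewrite cos2pi sin2pi cos0 sin0.
Qed.

(** The factor r^2 bounds exp(x)^2; the factor n appears because each of the n divergences is
    bounded by the full sum. *)
Let f_perturbation x y : x < ln r ->
  \sum_i (df i x y - s i x y) ^+ 2 <= r ^+ 2 * (n%:R * C) * \sum_i f i x y ^+ 2.
Proof.
move=> xr; have Pb := P_box y xr; have er := expr_le xr.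
have -> : \sum_i (df i x y - s i x y) ^+ 2 = \sum_(k < n) expR x ^+ 2 *
    (partial 0 (a k) (P x y) + partial 1 (b k) (P x y)) ^+ 2.
  rewrite big_split_ord/= -big_split/=; apply: eq_bigr => k _.
  rewrite /s join_familyl join_familyr /df /fy /G join_familyl join_familyr.
  exact: polar_divergence_curl (cos2Dsin2 y) (curl k (P_D y xr)).
have -> : \sum_i f i x y ^+ 2 = \sum_(k < n) (a k (P x y) ^+ 2 + b k (P x y) ^+ 2).
  rewrite big_split_ord/= -big_split/=; apply: eq_bigr => k _.
  by rewrite /f /G join_familyl join_familyr.
set A := \sum_(k < n) (_ + _).
have A0 : 0 <= A by apply: sumr_ge0 => k _; rewrite addr_ge0// sqr_ge0.
rewrite (_ : _ * A = \sum_(k < n) r ^+ 2 * (C * A)); last first.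
  by rewrite sumr_const card_ord -mulr_natl; ring.
apply: ler_sum => k _; rewrite ler_pM ?sqr_ge0//.
  by rewrite ler_pXn2r// nnegrE ?expR_ge0// ltW.
exact: div_le.
Qed.

Lemma polar_vanish (eps : R) : 0 < eps ->
  (forall q k, ball c eps q -> a k q = 0 /\ b k q = 0) ->
  forall x y k, x < ln r -> 0 <= y <= pi *+ 2 ->
  a k (P x y) = 0 /\ b k (P x y) = 0.
Proof.
move=> eps0 ab0 x y k xr y02.
(* The circle of radius exp(x1) lies where f is known to vanish, and x1 <= x. The evolution is run
   on the open interval from x1 - 1 to ln r, which contains both. *)
pose x1 := Num.min x (ln eps - 1).
have x1x : x1 <= x by rewrite /x1 ge_min lexx.
have x1eps : expR x1 < eps.
  rewrite -[ltRHS]lnK ?posrE// ltr_expR /x1 gt_min; apply/orP; right; lra.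
have [M hM] := bounds.
have lt_lnr t : x1 - 1 < t < ln r -> t < ln r by case/andP.
suff f0 i : f i x y = 0.
  have := f0 (lshift n k); have := f0 (rshift n k).
  by rewrite /f /G join_familyl join_familyr.
apply: (@evolution_vanish R (n + n) f df s (x1 - 1) (ln r) M (r ^+ 2 * (n%:R * C))
  _ _ _ _ _ _ _ _ _ _ _ x1 x _ x1x xr) => //.
- by move=> j t u /lt_lnr tr; exact: f_derive_x.
- by move=> j t /lt_lnr tr; exact: f_continuous_y.
- by move=> j t /lt_lnr tr; exact: df_continuous_y.
- move=> j t /lt_lnr tr; apply: (s_fy (Q := fun g => continuous (g t))) => {}j.
    exact: fy_continuous_y.
  by move=> u; apply: cvgN; exact: fy_continuous_y.
- move=> j t u /lt_lnr tr.
  apply: (s_fy (Q := fun g => {for t, continuous (g ^~ u)})) => {}j.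
    exact: fy_continuous_x.
  by apply: cvgN; exact: fy_continuous_x.
- by move=> j t u /lt_lnr tr; have [] := hM j t u tr.
- by move=> j t u /lt_lnr tr; have [] := hM j t u tr.
- move=> j t u /lt_lnr tr; apply: (s_fy (Q := fun g => `|g t u| <= M)) => {}j.
    by have [] := hM j t u tr.
  by rewrite normrN; have [] := hM j t u tr.
- by move=> t u /lt_lnr tr /lt_lnr ur; exact: s_symmetric.
- by rewrite mulr_ge0 ?sqr_ge0// mulr_ge0.
- by move=> t u /lt_lnr tr; exact: f_perturbation.
- lra.
- move=> j u; have Pc : ball c eps (P x1 u).
    rewrite {1}(pt_eta c); apply/ball_pt; rewrite !opprD !addrA !subrr !sub0r !normrN.
    have h (t : R) : `|t| <= 1 -> `|expR x1 * t| < eps.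
      move=> t1; rewrite normrM ger0_norm ?expR_ge0//.
      by rewrite (le_lt_trans _ x1eps)// ler_piMr// expR_ge0.
    by split; apply: h; [exact: cos_max|exact: sin_max].
  rewrite /f /G; apply: (join_family_ind (P := fun g => g (P x1 u) = 0)) => k'.
    by have [] := ab0 _ k' Pc.
  by have [] := ab0 _ k' Pc.
Qed.

End PolarContinuation.

(** * From discs to connected domains *)

Section UniqueContinuation.
Context {R : realType}.
Local Notation V := 'rV[R]_2.

Definition laplacian_bounded n (w : 'I_n -> V -> R^o) (K : set V) (C : R) :=
  forall k q, K q ->
  (partial 0 (partial 0 (w k)) q + partial 1 (partial 1 (w k)) q) ^+ 2 <=
  C * \sum_j (partial 0 (w j) q ^+ 2 + partial 1 (w j) q ^+ 2).

Lemma partial_eq0 (f : V -> R^o) (c : V) (eps : R) i : 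
  (forall q, ball c eps q -> f q = 0) ->
  forall q, ball c eps q -> partial i f q = 0.
Proof.
move=> f0 q cq; apply: etrans (derive_cst (0 : R^o) q (delta_mx 0 i)).
apply: near_eq_derive; have := ball_open c eps => ob.
by apply: filterS (open_nbhs_nbhs (conj ob cq)) => p; exact: f0.
Qed.

(** Balls here are squares, while circles around c sweep out the inscribed Euclidean disc; hence the
    explicit sum of squares. *)
Lemma disc_gradient_vanish n (w : 'I_n -> V -> R^o) (D : set V) (c : V)
    (rho eps : R) :
  open D -> ball c rho `<=` D -> (forall k, smooth_on D (w k)) ->
  (forall r, 0 < r < rho -> exists2 C, 0 <= C &
    laplacian_bounded w (closed_box c r) C) ->
  0 < eps -> (forall q k, ball c eps q -> w k q = 0) ->
  forall (q : V) k, (q 0 0 - c 0 0) ^+ 2 + (q 0 1 - c 0 1) ^+ 2 < rho ^+ 2 ->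
  0 < rho -> partial 0 (w k) q = 0 /\ partial 1 (w k) q = 0.
Proof.
move=> oD cD sw wC eps0 w0 q k; set d := _ + _ => drho rho0.
have g0 q' k' : ball c eps q' -> partial 0 (w k') q' = 0 /\ partial 1 (w k') q' = 0.
  by move=> cq; split; apply: (@partial_eq0 _ c eps) => // p; exact: w0.
have d0 : 0 <= d by rewrite addr_ge0// sqr_ge0.
(* The centre has no logarithmic radius and is covered by the vanishing near c. *)
have [dz|dnz] := eqVneq d 0.
  apply: g0; suff -> : q = c by exact: ballxx.
  move: dz => /eqP; rewrite paddr_eq0 ?sqr_ge0// !sqrf_eq0 !subr_eq0.
  by move=> /andP[/eqP q0 /eqP q1]; rewrite (pt_eta q) q0 q1 -pt_eta.
pose r0 := Num.sqrt d.
have r00 : 0 < r0 by rewrite sqrtr_gt0 lt_neqAle eq_sym dnz.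
have r02 : d = r0 ^+ 2 by rewrite sqr_sqrtr.
have r0rho : r0 < rho by rewrite -(@ltr_pXn2r _ 2)// ?nnegrE ?ltW// -r02.
have [y [y02 qx qy]] := polar_coordinates r00 r02.
(* Room on both sides: q lies strictly inside radius r, and the box of radius r stays inside the
   ball of radius rho. *)
pose r := (r0 + rho) / 2.
have r0r : r0 < r by rewrite /r; lra.
have rrho : r < rho by rewrite /r; lra.
have rpos : 0 < r := lt_trans r00 r0r.
have [|C C0 hC] := wC r; first by rewrite rpos.
have lr : ln r0 < ln r by rewrite ltr_ln ?posrE.
have := @polar_vanish R n (fun k => partial 0 (w k)) (fun k => partial 1 (w k))
  D c rho oD cD rho0 (fun k => smooth_on_partial 0 (sw k))
  (fun k => smooth_on_partial 1 (sw k))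
  (fun k q Dq => esym (smooth_partial_comm oD Dq (sw k)))
  r rpos rrho C C0 hC eps eps0 g0 (ln r0) y k lr y02.
by rewrite lnK ?posrE// -qx -qy !addrA ![_ + q 0 _]addrC !addrK -pt_eta.
Qed.

Lemma disc_continuation n (w : 'I_n -> V -> R^o) (D : set V) (c : V)
    (rho eps : R) :
  open D -> 0 < rho -> ball c rho `<=` D -> (forall k, smooth_on D (w k)) ->
  (forall r, 0 < r < rho -> exists2 C, 0 <= C &
    laplacian_bounded w (closed_box c r) C) ->
  0 < eps -> (forall q k, ball c eps q -> w k q = 0) ->
  forall (q : V) k, (q 0 0 - c 0 0) ^+ 2 + (q 0 1 - c 0 1) ^+ 2 < rho ^+ 2 ->
  w k q = 0.
Proof.
move=> oD rho0 cD sw wC eps0 w0 q k drho.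
pose dx := q 0 0 - c 0 0; pose dy := q 0 1 - c 0 1.
pose p t := pt (c 0 0 + t * dx) (c 0 1 + t * dy).
(* The whole diameter through q is used, since [mean_value] works on both sides of t = 0; w is
   constant along it and vanishes at the centre. *)
have pdisc t : `|t| <= 1 -> (p t 0 0 - c 0 0) ^+ 2 + (p t 0 1 - c 0 1) ^+ 2 < rho ^+ 2.
  move=> t1; rewrite !mxE/= ![c 0 _ + _]addrC !addrK.
  apply: le_lt_trans drho; rewrite -/dx -/dy !exprMn -mulrDr ler_piMl//.
    by rewrite addr_ge0// sqr_ge0.
  by rewrite -real_normK ?num_real// expr_le1.
have pball t : `|t| <= 1 -> ball c rho (p t).
  move=> /pdisc pt_; rewrite {1}(pt_eta c) [p t]pt_eta; apply/ball_pt.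
  have h (x z : R) : x ^+ 2 + z ^+ 2 < rho ^+ 2 -> `|x| < rho.
    move=> xz; rewrite -(@ltr_pXn2r _ 2)// ?nnegrE ?ltW// real_normK ?num_real//.
    by apply: le_lt_trans xz; rewrite lerDl sqr_ge0.
  by split; rewrite distrC; apply: h; [exact: pt_|rewrite addrC; exact: pt_].
have [|t] := @mean_value R (fun t => w k (p t)) (cst 0) 0 1.
  rewrite subr0 normr1 => t; rewrite subr0 => t1.
  have [g0 g1] := disc_gradient_vanish oD cD sw wC eps0 w0 k (pdisc t t1) rho0.
  have := @is_derive_curve R (w k) D (fun t => c 0 0 + t * dx)
    (fun t => c 0 1 + t * dy) dx dy t oD (cD _ (pball t t1))
    (fun q i Dq => (sw k [::] q Dq).2 i)
    (fun i => (sw k [:: i] _ (cD _ (pball t t1))).1).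
  rewrite -/(p t) g0 g1 !mulr0 addr0; apply.
    by apply: is_derive_eq; rewrite /GRing.scale/=; ring.
  by apply: is_derive_eq; rewrite /GRing.scale/=; ring.
rewrite mulr0 => _ /eqP; rewrite subr_eq0 => /eqP.
rewrite /p !mul1r !mul0r !addr0 /dx /dy ![c 0 _ + _]addrC !subrK -!pt_eta => ->.
by apply: w0; exact: ballxx.
Qed.

(** The interior of the zero set is open by definition; continuation on discs makes it closed in D,
    and connectedness does the rest. *)
Lemma unique_continuation n (w : 'I_n -> V -> R^o) (D : set V) (q0 : V) :
  open D -> connected D -> (forall k, smooth_on D (w k)) ->
  (forall c r, closed_box c r `<=` D -> exists2 C, 0 <= C &
    laplacian_bounded w (closed_box c r) C) ->
  D q0 -> (\forall q \near q0, forall k, w k q = 0) ->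
  forall q k, D q -> w k q = 0.
Proof.
move=> oD cD sw wC Dq0 wq0.
pose Z := [set q | forall k, w k q = 0].
have closedZ p : D p -> closure (interior Z) p -> interior Z p.
  move=> Dp clp.
  have /nbhs_ballP[rho /= rho0 rhoD] : nbhs p D by exact: open_nbhs_nbhs.
  (* The disc must be centred where w already vanishes nearby: at a point c of the interior within r
     / 2 of p. As r is half of rho, the ball of radius r around c stays in D. *)
  pose r := rho / 2; have r0 : 0 < r by rewrite divr_gt0.
  have r2 : 0 < r / 2 by rewrite divr_gt0.
  have [c [cZ pc]] := clp _ (nbhsx_ballx p _ r2).
  have /nbhs_ballP[eps /= eps0 epsZ] := cZ.
  have cDr : ball c r `<=` D.
    move=> q cq; apply: rhoD; rewrite (splitr rho); apply: ball_triangle cq.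
    by apply: le_ball pc; rewrite ler_pdivrMr// ler_pMr// ler1n.
  (* Points within r / 10 of p differ from c by less than 6 r / 10 in each coordinate, and 2 (6 /
     10)^2 = 18 / 25 < 1 puts them in the Euclidean disc of radius r. *)
  have r10 : 0 < r / 10 by rewrite divr_gt0.
  apply/nbhs_ballP; exists (r / 10) => //= q pq k.
  apply: (@disc_continuation n w D c r eps oD r0 cDr sw _ eps0) => //.
  - move=> r' /andP[_ r'r]; apply: wC; apply: subset_trans cDr.
    exact: closed_box_ball.
  - by move=> q' k' cq'; exact: epsZ.
  have sm i : (q 0 i - c 0 i) ^+ 2 <= (r * (6 / 10)) ^+ 2.
    have h1 : `|p 0 i - c 0 i| < r / 2 by exact: pc.2.
    have h2 : `|p 0 i - q 0 i| < r / 10 by exact: pq.2.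
    rewrite -[leLHS]real_normK ?num_real// ler_pXn2r ?nnegrE//; last lra.
    rewrite (_ : q 0 i - c 0 i = (p 0 i - c 0 i) - (p 0 i - q 0 i)); last by ring.
    by rewrite (le_trans (ler_normB _ _))//; lra.
  apply: le_lt_trans (lerD (sm 0) (sm 1)) _.
  have : 0 < r ^+ 2 by rewrite exprn_gt0.
  by rewrite (_ : _ + _ = 18 / 25 * r ^+ 2); [lra|field].
have ZD : D `&` interior Z = D.
  apply: cD.
  - by exists q0; split.
  - by exists (interior Z) => //; exact: open_interior.
  - exists (closure (interior Z)); first exact: closed_closure.
    apply/seteqP; split => p [Dp].
      by move=> /subset_closure.
    by move=> /(closedZ _ Dp).
move=> q k Dq; have : (D `&` interior Z) q by rewrite ZD.
by move=> [_ /interior_subset]; exact.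
Qed.

End UniqueContinuation.

(** * Surfaces with the same mean curvature *)

(** This provides the point near which the two maps agree. With an empty boundary D would be open
    and closed, and so would its trace on a line joining D to its complement, against the
    connectedness of R. *)
Lemma boundary_nonempty (R : realType) (W : normedModType R) (D : set W) :
  open D -> D !=set0 -> D `<` setT -> boundary D !=set0.
Proof.
move=> oD [p Dp] [_ nD]; apply: contrapT => /set0P/negP/negPn/eqP bD0.
have [q nDq] : exists q, ~ D q.
  by apply: contrapT => h; apply: nD => q _; apply: contrapT => nDq; apply: h; exists q.
have cD : closed D.
  move=> x clx; apply: contrapT => nDx.
  suff : boundary D x by rewrite bD0.
  by split=> // /interior_subset.
pose g (t : R) := p + t *: (q - p).
have gc : continuous g.
  move=> t; apply: cvgD; first exact: cvg_cst.
  by apply: cvgZl; exact: cvg_id.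
have cR : connected [set: R] by apply/connected_intervalP.
have gD : g @^-1` D = setT.
  apply: cR; first by exists 0; rewrite /g /= scale0r addr0.
  - exists (g @^-1` D); last by rewrite setTI.
    by move/continuousP: gc; apply.
  - exists (g @^-1` D); last by rewrite setTI.
    by move/continuous_closedP: gc; apply.
have : (g @^-1` D) 1 by rewrite gD.
by rewrite /g /= scale1r addrCA subrr addr0.
Qed.

Lemma sqr_combination_le (R : realDomainType) (M p q u v a b c d S : R) :
  `|p| <= M -> `|q| <= M -> `|u| <= M -> `|v| <= M ->
  a ^+ 2 <= S -> b ^+ 2 <= S -> c ^+ 2 <= S -> d ^+ 2 <= S ->
  (a * p - b * q + (u * c - v * d)) ^+ 2 <= 16 * M ^+ 2 * S.
Proof.
have mul_le x y : `|x| <= M -> y ^+ 2 <= S -> (x * y) ^+ 2 <= M ^+ 2 * S.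
  move=> xM yS; rewrite exprMn ler_pM ?sqr_ge0//.
  by rewrite -[leLHS]real_normK ?num_real// ler_pXn2r ?nnegrE// (le_trans _ xM).
move=> pM qM uM vM aS bS cS dS.
have h1 := mul_le _ _ pM aS; have h2 := mul_le _ _ qM bS.
have h3 := mul_le _ _ uM cS; have h4 := mul_le _ _ vM dS.
rewrite [a * p]mulrC [b * q]mulrC -mulrA.
move: (p * a) (q * b) (u * c) (v * d) (M ^+ 2 * S) h1 h2 h3 h4 => x y z t B h1 h2 h3 h4.
(* These six squares add up to 4 (x^2 + y^2 + z^2 + t^2) - (x - y + z - t)^2, and each of the four
   squares is at most B. *)
have := sqr_ge0 (x + y); have := sqr_ge0 (x - z); have := sqr_ge0 (x + t).
have := sqr_ge0 (y + z); have := sqr_ge0 (y - t); have := sqr_ge0 (z + t).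
nra.
Qed.

(** One coordinate of u' × v' - u × v = (u' - u) × v' + u × (v' - v): every term keeps one
    difference, to be estimated by the gradient of w, and one factor bounded on compact sets. *)
Lemma cross_difference (R : comPzRingType)
    (h a b a' b' u1 u2 v1 v2 u1' u2' v1' v2' : R) :
  a' + b' = h * (u1' * v2' - u2' * v1') -> a + b = h * (u1 * v2 - u2 * v1) ->
  a' - a + (b' - b) =
  h * ((u1' - u1) * v2' - (u2' - u2) * v1' + (u1 * (v2' - v2) - u2 * (v1' - v1))).
Proof.
move=> e' e; transitivity (a' + b' - (a + b)); first by ring.
by rewrite e' e; ring.
Qed.

Lemma sqr_scale_le (R : realDomainType) (h m x B S : R) :
  `|h| <= m -> x ^+ 2 <= B * S -> (2 * h * x) ^+ 2 <= (2 * m) ^+ 2 * B * S.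
Proof.
move=> hm xS; rewrite exprMn -mulrA ler_pM ?sqr_ge0// !exprMn ler_pM ?sqr_ge0//.
by rewrite -[leLHS]real_normK ?num_real// ler_pXn2r ?nnegrE// (le_trans _ hm).
Qed.

Lemma sqr_le_add (R : realDomainType) (x y S : R) :
  x ^+ 2 + y ^+ 2 <= S -> x ^+ 2 <= S /\ y ^+ 2 <= S.
Proof. by move=> le; split; apply: le_trans le; rewrite ?lerDl ?lerDr sqr_ge0. Qed.

Lemma coord_cross (R : realType) (a b x y : 'rV[R]_3) (t : R) k :
  a + b = t *: cross x y -> a 0 k + b 0 k =
  t * (x 0 (k + 1) * y 0 (k + 2%:R) - x 0 (k + 2%:R) * y 0 (k + 1)).
Proof. by move=> /(congr1 (fun z : 'rV[R]_3 => z 0 k)); rewrite !mxE. Qed.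

Lemma continuous_at_sum (R : numFieldType) (T : topologicalType) n
    (g : 'I_n -> T -> R) (t : T) : (forall i, {for t, continuous (g i)}) ->
  {for t, continuous (fun t => \sum_i g i t)}.
Proof.
by move=> gc; apply: cvg_big => [|i _]; [exact: add_continuous|exact: gc].
Qed.

Section Surfaces.
Context {R : realType}.
Local Notation V := 'rV[R]_2.
Variables (D : set V) (S S' : set 'rV[R]_3) (phi phi' : V -> 'rV[R]_3).
Variables (lambda H : V -> R).
Hypothesis oD : open D.
Hypotheses (conf : conformal_parameterization D S phi lambda)
  (conf' : conformal_parameterization D S' phi' lambda).
Hypotheses (curv : mean_curvature_on D phi H) (curv' : mean_curvature_on D phi' H).

Let sphi : smooth_on D phi. Proof. by case: conf => -[]. Qed.
Let sphi' : smooth_on D phi'. Proof. by case: conf' => -[]. Qed.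

Definition coord_diff (k : 'I_3) : V -> R^o := fun q => phi' q 0 k - phi q 0 k.

Lemma smooth_coord_diff k : smooth_on D (coord_diff k).
Proof. by apply: smooth_onB => //; exact: smooth_on_coord. Qed.

Lemma iter_partial_coord_diff s k p : D p ->
  iter_partial s (coord_diff k) p =
  iter_partial s phi' p 0 k - iter_partial s phi p 0 k.
Proof.
move=> Dp; have E' := iter_partial_coord k oD sphi' s Dp.
have E := iter_partial_coord k oD sphi s Dp.
apply: etrans (congr2 (fun x y => x - y) E' E).
exact: (iter_partialB oD (smooth_on_coord k oD sphi') (smooth_on_coord k oD sphi) s Dp).
Qed.

(** Pairing the mean curvature equation with N = phi_u × phi_v, where |N|^2 = lambda^4, expresses H
    on D as a quotient of continuous functions. *)
Lemma curvature_bounded c r : closed_box c r `<=` D ->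
  exists M, forall q, closed_box c r q -> `|H q| <= M.
Proof.
move=> KD.
have [_ slambda lam0 _] := conf.
pose N k q := partial 0 phi q 0 (k + 1) * partial 1 phi q 0 (k + 2%:R) -
  partial 0 phi q 0 (k + 2%:R) * partial 1 phi q 0 (k + 1) : R.
pose L k q := partial 0 (partial 0 phi) q 0 k + partial 1 (partial 1 phi) q 0 k : R.
pose h q := (\sum_k L k q * N k q) / (2 * lambda q ^+ 4).
have coordc s k q : D q -> {for q, continuous (fun q => iter_partial s phi q 0 k)}.
  move=> Dq; exact: (continuous_comp (sphi s Dq).1 (@coord_continuous R _ _ 0 k _)).
(* The dummy index makes h a family with one member, the form that [bounded_on_box] takes. *)
have hc (i : 'I_1) q : D q -> {for q, continuous h}.
  move=> Dq.
  have Lc k : {for q, continuous (L k)}.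
    by apply: continuousD; [exact: (coordc [:: 0; 0])|exact: (coordc [:: 1; 1])].
  have Nc k : {for q, continuous (N k)}.
    by apply: continuousB; apply: continuousM; [exact: (coordc [:: 0])
      |exact: (coordc [:: 1])|exact: (coordc [:: 0])|exact: (coordc [:: 1])].
  have lc : {for q, continuous (lambda : V -> R)} by exact: (slambda [::] q Dq).1.
  have l4 : {for q, continuous (fun q => lambda q ^+ 4)}.
    exact: (continuous_comp lc (@exprn_continuous R 4 _)).
  have sum_c : {for q, continuous (fun q => \sum_k L k q * N k q)}.
    by apply: continuous_at_sum => k; apply: continuousM; [exact: Lc|exact: Nc].
  have den_c : {for q, continuous (fun q => 2 * lambda q ^+ 4)}.
    by apply: continuousM; [exact: cst_continuous|exact: l4].
  apply: (continuousM sum_c); apply: continuousV; last exact: den_c.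
  by rewrite mulf_neq0// expf_neq0// gt_eqF// lam0.
have [M hM] := bounded_on_box hc KD.
exists M => q Kq; suff -> : H q = h q by exact: hM ord0 q Kq.
have Dq := KD _ Kq; have lq := lam0 q Dq.
have [_ _ _ /(_ q Dq)[uv uu vv]] := conf.
have mce := mean_curvature_equation oD Dq conf curv.
have NN := dot_cross_conformal uv uu vv.
have LN : \sum_k L k q * N k q = 2 * H q * lambda q ^+ 4.
  rewrite -NN -dotZl -mce; apply: eq_bigr => k _.
  by rewrite [X in _ = X * _]mxE [X in _ = _ * X]mxE.
by rewrite /h LN; field; rewrite gt_eqF.
Qed.

Lemma coord_diff_laplacian_bounded c r : closed_box c r `<=` D ->
  exists2 C, 0 <= C & laplacian_bounded coord_diff (closed_box c r) C.
Proof.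
move=> KD; have [MH hMH] := curvature_bounded KD.
have coordc (psi : V -> 'rV[R]_3) (spsi : smooth_on D psi) i (k : 'I_3) q :
    D q -> {for q, continuous (fun q => partial i psi q 0 k)}.
  move=> Dq; exact: (continuous_comp (spsi [:: i] q Dq).1 (@coord_continuous R _ _ 0 k _)).
have [M1 hM1] := bounded_on_box (coordc _ sphi 0) KD.
have [M2 hM2] := bounded_on_box (coordc _ sphi' 1) KD.
pose M := `|M1| + `|M2|.
have uM q k : closed_box c r q -> `|partial 0 phi q 0 k| <= M.
  by move=> Kq; rewrite (le_trans (hM1 k q Kq))// (le_trans (ler_norm _))// lerDl.
have vM q k : closed_box c r q -> `|partial 1 phi' q 0 k| <= M.
  by move=> Kq; rewrite (le_trans (hM2 k q Kq))// (le_trans (ler_norm _))// lerDr.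
(* (2 MH)^2 comes from the factor 2 H, and 16 M^2 from the four products in a coordinate of the
   telescoped cross product. *)
exists ((2 * MH) ^+ 2 * (16 * M ^+ 2)).
  by rewrite mulr_ge0 ?sqr_ge0// mulr_ge0// sqr_ge0.
move=> k q Kq; have Dq := KD _ Kq.
have lap (i : 'I_2) : partial i (partial i (coord_diff k)) q =
    partial i (partial i phi') q 0 k - partial i (partial i phi) q 0 k.
  exact: (iter_partial_coord_diff [:: i; i] k Dq).
have grad (i : 'I_2) j : partial i (coord_diff j) q =
    partial i phi' q 0 j - partial i phi q 0 j.
  exact: (iter_partial_coord_diff [:: i] j Dq).
pose W i j := partial i phi' q 0 j - partial i phi q 0 j.
have -> : partial 0 (partial 0 (coord_diff k)) q +
    partial 1 (partial 1 (coord_diff k)) q =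
  2 * H q * (W 0 (k + 1) * partial 1 phi' q 0 (k + 2%:R) -
     W 0 (k + 2%:R) * partial 1 phi' q 0 (k + 1) +
     (partial 0 phi q 0 (k + 1) * W 1 (k + 2%:R) -
      partial 0 phi q 0 (k + 2%:R) * W 1 (k + 1))).
  have E := coord_cross k (mean_curvature_equation oD Dq conf curv).
  have E' := coord_cross k (mean_curvature_equation oD Dq conf' curv').
  apply: etrans (congr2 +%R (lap 0) (lap 1)) _.
  exact: cross_difference E' E.
have -> : \sum_j (partial 0 (coord_diff j) q ^+ 2 + partial 1 (coord_diff j) q ^+ 2) =
    \sum_j (W 0 j ^+ 2 + W 1 j ^+ 2).
  have sqD (x y x' y' : R) : x = x' -> y = y' -> x ^+ 2 + y ^+ 2 = x' ^+ 2 + y' ^+ 2.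
    by move=> -> ->.
  by apply: eq_bigr => j _; exact: sqD (grad 0 j) (grad 1 j).
set Sm := \sum_j _.
have Wle j : W 0 j ^+ 2 <= Sm /\ W 1 j ^+ 2 <= Sm.
  have Tle : W 0 j ^+ 2 + W 1 j ^+ 2 <= Sm.
    rewrite /Sm (bigD1 j)//= lerDl; apply: sumr_ge0 => l _.
    by rewrite addr_ge0// sqr_ge0.
  exact: sqr_le_add Tle.
have W0 j := (Wle j).1; have W1 j := (Wle j).2.
apply: sqr_scale_le (hMH q Kq) _.
by apply: sqr_combination_le; [exact: vM|exact: vM|exact: uM|exact: uM
  |exact: W0|exact: W0|exact: W1|exact: W1].
Qed.

End Surfaces.

Unset Implicit Arguments.

Theorem theorem4p1 (R : realType)
  (D : set 'rV[R]_2) (S : set 'rV[R]_3) (phi : 'rV[R]_2 -> 'rV[R]_3)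
  (lambda H : 'rV[R]_2 -> R) (U V : set 'rV[R]_2)
  (D_open : open D) (D_connected : connected D)
  (D_nonempty : D !=set0) (D_proper : D `<` [set: 'rV[R]_2])
  (S_surface : open_surface S)
  (phi_conformal : conformal_parameterization D S phi lambda)
  (phi_curvature : mean_curvature_on D phi H)
  (V_open : open V) (V_boundary : boundary D `<=` V) (U_def : U = D `&` V)
  (S' : set 'rV[R]_3) (phi' : 'rV[R]_2 -> 'rV[R]_3)
  (S'_surface : open_surface S')
  (phi'_conformal : conformal_parameterization D S' phi' lambda)
  (phi'_curvature : mean_curvature_on D phi' H)
  (phi'_boundary : forall p, U p -> phi' p = phi p) :
  (forall p, D p -> phi' p = phi p) /\ S' = S.
Proof.
have eq_on p : D p -> phi' p = phi p.
  move=> Dp; apply/rowP => k; apply/eqP; rewrite -subr_eq0; apply/eqP.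
  (* V is a neighbourhood of a point in the closure of D, so it meets D; around the point q0 found
     there the two maps agree. *)
  have [p0 bp0] := boundary_nonempty D_open D_nonempty D_proper.
  have Vp0 : nbhs p0 V by apply: open_nbhs_nbhs; split => //; exact: V_boundary.
  have [q0 [Dq0 Vq0]] := bp0.1 V Vp0.
  apply: (unique_continuation (w := coord_diff phi phi') D_open D_connected _ _ Dq0).
  - by move=> j; exact: (smooth_coord_diff D_open phi_conformal phi'_conformal).
  - move=> c r; exact: (coord_diff_laplacian_bounded D_open phi_conformal
      phi'_conformal phi_curvature phi'_curvature).
  - have oU : open_nbhs q0 U by rewrite U_def; split => //; exact: openI.
    apply: filterS (open_nbhs_nbhs oU) => q Uq j.
    by rewrite /coord_diff phi'_boundary// subrr.
  - exact: Dp.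
split=> //.
have [[_ [f_S _ surj_S] _] _ _ _] := phi_conformal.
have [[_ [f_S' _ surj_S'] _] _ _ _] := phi'_conformal.
apply/seteqP; split => x Sx.
- by have [p Dp <-] := surj_S' x Sx; rewrite eq_on//; exact: f_S.
- by have [p Dp <-] := surj_S x Sx; rewrite -eq_on//; exact: f_S'.
Qed.
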